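(* For Lebesgue almost every $x\in(0,1)$, $$\lim_{n\to\infty}\frac{S_n(x)-\max_{1\le i\le n}a_i(x)a_{i+1}(x)}{n\log^2 n}=\frac{1}{2\log 2}.$$
   Context: Every irrational $x\in(0,1)$ has a unique simple continued fraction expansion $x=[a_1(x),a_2(x),a_3(x),\ldots]=\cfrac{1}{a_1(x)+\cfrac{1}{a_2(x)+\cdots}}$ with positive integers $a_n(x)$ (partial quotients). For irrational $x\in(0,1)$ and $n\ge1$, $S_n(x)=\sum_{i=1}^n a_i(x)a_{i+1}(x)$. $\log$ is the natural logarithm and $\log^2 n=(\log n)^2$. *)

(* Defs.v *)
From mathcomp Require Import all_boot all_order all_algebra.
From mathcomp Require Import all_classical all_reals all_analysis.
From mathcomp Require Import ring lra.
Import Order.TTheory GRing.Theory Num.Theory numFieldNormedType.Exports.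

Set Implicit Arguments.
Unset Strict Implicit.
Unset Printing Implicit Defensive.

Local Open Scope classical_set_scope.
Local Open Scope ring_scope.

(* The finite continued fraction 1/(a_i + 1/(a_(i+1) + ... + 1/a_(i+n-1))). *)
Fixpoint cf_frac (R : realType) (a : nat -> nat) (i n : nat) : R :=
  if n is m.+1 then ((a i)%:R + cf_frac R a i.+1 m)^-1 else 0.

(* x = [a_1, a_2, ...]: the finite continued fractions [a_1, ..., a_n] converge
   to x. The entry a_0 is the integer part, which is 0 on (0,1). *)
Definition is_cf_expansion (R : realType) (x : R) (a : nat -> nat) : Prop :=
  [/\ a 0%N = 0%N,
      forall n, (0 < n)%N -> (0 < a n)%N &
      cf_frac R a 1 n @[n --> \oo] --> x].

(* a_n(x). When x has no infinite expansion, the sequence is identically 0. *)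
Definition partial_quotient (R : realType) (x : R) : nat -> nat :=
  xget (fun=> 0%N) [set a | is_cf_expansion x a].

Definition cf_S (R : realType) (x : R) (n : nat) : nat :=
  (\sum_(1 <= i < n.+1) (partial_quotient x i * partial_quotient x i.+1))%N.

Definition cf_max (R : realType) (x : R) (n : nat) : nat :=
  (\max_(1 <= i < n.+1) (partial_quotient x i * partial_quotient x i.+1))%N.

Section WellDefined.
Variable R : realType.
Implicit Types (x : R) (a b : nat -> nat) (t : nat -> R).

Lemma cf_frac_itv a i n : (forall k, (0 < k)%N -> (0 < a k)%N) -> (0 < i)%N ->
  0 <= cf_frac R a i n <= 1.
Proof.
move=> a0; elim: n i => [|n IH] i i0 /=; first by rewrite lexx ler01.
have /andP[c0 c1] := IH i.+1 isT.
have a1 : 1 <= (a i)%:R :> R by rewrite ler1n a0.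
have d1 : 1 <= (a i)%:R + cf_frac R a i.+1 n by lra.
by rewrite invr_ge0 invf_le1 ?(lt_le_trans ltr01)// d1 (le_trans ler01).
Qed.

Lemma cf_step (p q c t : R) : 1 <= p -> 1 <= q -> 0 <= c -> 0 <= t ->
  `|(p + (q + c)^-1)^-1 - (p + (q + t)^-1)^-1| <= `|c - t| / 2.
Proof.
move=> p1 q1 c0 t0.
have qc : 0 < q + c by lra.
have qt : 0 < q + t by lra.
have E (u : R) : 0 <= u -> (p + (q + u)^-1)^-1 = (q + u) / (p * (q + u) + 1).
  move=> u0; have qu : 0 < q + u by lra.
  have -> : p + (q + u)^-1 = (p * (q + u) + 1) / (q + u).
    by rewrite mulrDl mulfK ?gt_eqF// div1r.
  by rewrite invf_div.
rewrite !E//.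
have pc : 2 <= p * (q + c) + 1 by nra.
have pt : 2 <= p * (q + t) + 1 by nra.
have -> : (q + c) / (p * (q + c) + 1) - (q + t) / (p * (q + t) + 1) =
  (c - t) / ((p * (q + c) + 1) * (p * (q + t) + 1)).
  by field; rewrite !gt_eqF//; lra.
rewrite normrM ler_wpM2l// normfV ger0_norm; last by nra.
by rewrite lef_pV2 ?posrE; nra.
Qed.

Lemma cf_frac_cvg a t : (forall k, (0 < k)%N -> (0 < a k)%N) ->
  (forall i, (0 < i)%N -> 0 <= t i <= 1 /\ t i = ((a i)%:R + t i.+1)^-1) ->
  cf_frac R a 1 n @[n --> \oo] --> t 1%N.
Proof.
move=> a0 ht.
have err n i : (0 < i)%N -> `|cf_frac R a i n - t i| <= (1 / 2) ^+ n./2.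
  elim/ltn_ind: n i => -[|[|n]] IH i i0.
  - have [ti _] := ht i i0; rewrite sub0r normrN expr0 ger0_norm; lra.
  - have [ti _] := ht i i0; have ci := cf_frac_itv 1 a0 i0.
    by rewrite expr0 ler_norml; lra.
  - have /andP[c0 c1] := cf_frac_itv n a0 (isT : (0 < i.+2)%N).
    have [ti1 Ei] := ht i i0; have [_ Ei1] := ht i.+1 isT.
    have [ti2 _] := ht i.+2 isT.
    rewrite Ei Ei1 [(n.+2)./2]/= exprS.
    apply: le_trans (cf_step _ _ _ _) _; rewrite ?ler1n ?a0//; first by lra.
    by have := IH n (leqW (ltnSn n)) i.+2 isT; lra.
apply/cvgrPdist_le => e e0.
have g0 : (1 / 2) ^+ n @[n --> \oo] --> (0 : R).
  by apply: cvg_expr; rewrite ger0_norm; lra.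
have /cvgrPdist_le/(_ e e0)[N _ HN] := g0.
exists N.*2 => // n /= Nn; rewrite distrC.
apply: le_trans (err n 1%N isT) _.
have /= := HN n./2; rewrite sub0r normrN ger0_norm; last by rewrite exprn_ge0//; lra.
by apply; rewrite -[N]doubleK half_leq.
Qed.


Let gauss x : R := x^-1 - (Num.truncn x^-1)%:R.
Let irr01 x := 0 < x < 1 /\ irrational x.

Lemma irrationalV_subn x k : irrational x -> irrational (x^-1 - k%:R).
Proof.
move=> hx [q _ qE]; apply: hx; exists (q + k%:R)^-1 => //.
by rewrite fmorphV rmorphD/= ratr_nat qE subrK invrK.
Qed.

Lemma irr01_itv x : 0 <= x <= 1 -> irrational x -> irr01 x.
Proof.
move=> /andP[x0 x1] hx; split=> //; rewrite !lt_neqAle x0 x1 !andbT.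
apply/andP; split; apply/eqP => E; apply: hx.
- by exists 0 => //; rewrite rmorph0.
- by exists 1 => //; rewrite rmorph1.
Qed.

Lemma irr01_gauss x : irr01 x -> irr01 (gauss x).
Proof.
move=> [/andP[x0 x1] hx]; apply: irr01_itv; last exact: irrationalV_subn.
have := truncn_itv (ltW (_ : 0 < x^-1)); rewrite invr_gt0 => /(_ x0).
by rewrite -natr1 /gauss; lra.
Qed.

Lemma irr01_iter x i : irr01 x -> irr01 (iter i gauss x).
Proof. by move=> hx; elim: i => //= i; exact: irr01_gauss. Qed.

Lemma cf_tail a i x : (forall k, (0 < k)%N -> (0 < a k)%N) -> (0 < i)%N ->
  irr01 x -> cf_frac R a i n @[n --> \oo] --> x ->
  a i = Num.truncn x^-1 /\ cf_frac R a i.+1 n @[n --> \oo] --> gauss x.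
Proof.
move=> a0 i0 [/andP[x0 x1] hx] cx.
have cy : cf_frac R a i.+1 n @[n --> \oo] --> x^-1 - (a i)%:R.
  have c0 : (cf_frac R a i n)^-1 @[n --> \oo] --> x^-1.
    by apply: cvgV => //; rewrite gt_eqF.
  have c1 : (cf_frac R a i n.+1)^-1 @[n --> \oo] --> x^-1.
    by move: c0; rewrite -(cvg_shiftS (fun n => (cf_frac R a i n)^-1)).
  have -> : cf_frac R a i.+1 = (fun n => (cf_frac R a i n.+1)^-1 - (a i)%:R).
    by apply/funext => n; rewrite /= invrK addrC addKr.
  by apply: cvgB => //; exact: cvg_cst.
have [/andP[y0 y1] _] : irr01 (x^-1 - (a i)%:R).
  apply: irr01_itv; last exact: irrationalV_subn.
  have cl := cf_frac_itv _ a0 (isT : (0 < i.+1)%N).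
  apply/andP; split.
  - by apply: (cvgr_to_ge cy _); near=> n; have /andP[] := cl n.
  - by apply: (cvgr_to_le cy _); near=> n; have /andP[] := cl n.
have E : Num.truncn x^-1 = a i.
  by apply: truncn_def; rewrite -natr1; lra.
by rewrite /gauss E.
Unshelve. all: end_near. Qed.

Lemma exists_unique_cf_expansion x : 0 < x < 1 -> irrational x ->
  exists! a, is_cf_expansion x a.
Proof.
move=> x01 irrx; have hx : irr01 x by [].
pose t i := iter i.-1 gauss x.
have ht i : irr01 (t i) by exact: irr01_iter.
pose a i := if i is j.+1 then Num.truncn (t j.+1)^-1 else 0%N.
exists a; split.
  have a0 n : (0 < n)%N -> (0 < a n)%N.
    case: n => // n _; rewrite truncn_gt0.
    have [/andP[t0 t1] _] := ht n.+1.
    by rewrite invf_ge1// ltW.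
  split => //; rewrite -[x in _ --> x]/(t 1%N).
  apply: cf_frac_cvg => // -[//|i] _.
  have [/andP[t0 t1] _] := ht i.+1; split; first by rewrite !ltW.
  by rewrite /= /gauss addrC subrK invrK.
move=> b [b0 b1 bx]; apply/funext => -[|i]; first by rewrite b0.
have H j : cf_frac R b j.+1 n @[n --> \oo] --> iter j gauss x.
  by elim: j => // j IH; have [] := cf_tail b1 (ltn0Sn j) (irr01_iter j hx) IH.
by have [-> _] := cf_tail b1 (ltn0Sn i) (irr01_iter i hx) (H i).
Qed.

Lemma partial_quotientP x : 0 < x < 1 -> irrational x ->
  is_cf_expansion x (partial_quotient x).
Proof.
move=> x01 hx; have [a [ha _]] := exists_unique_cf_expansion x01 hx.
by apply: (@xgetPex _ _ [set b | is_cf_expansion x b]); exists a.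
Qed.

End WellDefined.

(* Main.v *)
Require Import Defs.
From mathcomp Require Import all_boot all_order all_algebra.
From mathcomp Require Import all_classical all_reals all_analysis.
From mathcomp Require Import measurable_realfun ring lra.
Import Order.TTheory GRing.Theory Num.Theory numFieldNormedType.Exports.
Local Open Scope classical_set_scope.
Local Open Scope ring_scope.

Set Implicit Arguments.
Unset Strict Implicit.
Unset Printing Implicit Defensive.

(* Under Lebesgue measure, s_n = q_(n-1) / q_n drives the digits: given s_n = s, the
   next digit is a with probability P_s(a) = (1 + s) / ((a + s) (a + s + 1)), and then
   s_(n+1) = 1 / (a + s). The transfer operator U h(s) = E_s[h(1 / (a + s))] turns
   nondecreasing functions into nonincreasing ones and maps w(s) = s / (1 + 2 s) to
   1 / (2 (2 + s)), so it halves Lipschitz constants with respect to w.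

   Truncate the products a_i a_(i+1) at T = n (log n)^(7/4). The conditional mean of a
   truncated product is (1 + s) (log T)^2 / 2 + O(log T), and the mean of 1 + s under
   the Gauss measure, which U preserves, is 1 / log 2; hence the truncated sum has mean
   ~ n (log n)^2 / (2 log 2). A martingale argument bounds its variance by
   O(n T log T). Two products exceed T with probability O((log n)^(-5/4)); otherwise
   removing the maximum changes the truncated sum by at most T. By Borel-Cantelli the
   limit holds along n = c^k for every c > 1, and it extends to all n because the
   trimmed sum is nondecreasing in n. *)

(** * Expectation of one digit *)

(** The products have infinite mean, and the bound for one exceedance of T among n products is of
    order (log n)^(-3/4), not summable along n = c^k: this is what removing the maximum repairs. For
    T = n (log n)^u the Chebyshev bound is of order (log n)^(u - 3), while two exceedances cost (log
    n)^(1/2 - u) if they share a digit and (log n)^(2 - 2u) otherwise. All three are summable along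
    c^k, and T = o(n (log n)^2), exactly for 3/2 < u < 2; 7/4 is the midpoint.

    Neighbouring products share a digit. Instead of mixing estimates, the proof uses that the pair
    (last digit, s) is a Markov chain: every estimate is an induction on words that conditions on
    the first digit. The halving of Lipschitz constants bounds the oscillation of conditional means
    uniformly in the number of remaining digits. No probability space of digits is built:
    [word_prob] is an iterated expectation, and [cylinders_measure] is the passage from words to
    Lebesgue measure. *)

Definition digit_prob {R : realType} (s : R) (a : nat) : R :=
  (1 + s) / ((a%:R + s) * (a%:R + s + 1)).

(** A real limit, so that linearity holds as equations in [R]; it is meaningful for [digit_bounded]
    functions, and [G 0] never enters. *)
Definition digit_exp {R : realType} (s : R) (G : nat -> R) : R :=
  limn (series (fun k => digit_prob s k.+1 * G k.+1)).

Definition digit_bounded {R : realType} (G : nat -> R) : Prop :=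
  exists M : R, forall a, (0 < a)%N -> `|G a| <= M.

Section DigitExpectation.
Variable R : realType.
Implicit Types (s t : R) (G H : nat -> R) (a n : nat).

Lemma digit_prob_gt0 s a : 0 <= s -> (0 < a)%N -> 0 < digit_prob s a.
Proof.
move=> s0 a0; have a1 : 1 <= a%:R :> R by rewrite ler1n.
by rewrite /digit_prob divr_gt0//; [lra|rewrite mulr_gt0//; lra].
Qed.

Lemma digit_prob_ge0 s a : 0 <= s -> (0 < a)%N -> 0 <= digit_prob s a.
Proof. by move=> s0 a0; apply/ltW/digit_prob_gt0. Qed.

Lemma digit_prob_telescope s a : 0 <= s -> (0 < a)%N ->
  digit_prob s a = (1 + s) / (a%:R + s) - (1 + s) / (a.+1%:R + s).
Proof.
move=> s0 a0; have a1 : 1 <= a%:R :> R by rewrite ler1n.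
by rewrite /digit_prob -natr1; field; rewrite !gt_eqF//; lra.
Qed.

Lemma sum_digit_prob s n : 0 <= s ->
  \sum_(0 <= k < n) digit_prob s k.+1 = 1 - (1 + s) / (n.+1%:R + s).
Proof.
move=> s0; elim: n => [|n IH].
  by rewrite big_geq// divff ?subrr// gt_eqF//; lra.
by rewrite big_nat_recr//= IH digit_prob_telescope//; lra.
Qed.

Lemma cvg_inv_natS s : 0 <= s ->
  ((1 + s) / (n.+1%:R + s)) @[n --> \oo] --> (0 : R).
Proof.
move=> s0; apply: (@squeeze_cvgr _ _ _ _ (fun=> 0) (fun n => (1 + s) * harmonic n)).
- near=> n; have n1 : 1 <= n.+1%:R :> R by rewrite ler1n.
  rewrite divr_ge0/=; [|lra|lra]; rewrite ler_wpM2l//; first lra.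
  by rewrite lef_pV2 ?posrE; lra.
- exact: cvg_cst.
- by rewrite -[X in _ --> X](mulr0 (1 + s)); apply: cvgM;
    [exact: cvg_cst|exact: cvg_harmonic].
Unshelve. all: end_near. Qed.

Lemma cvg_sum_digit_prob s : 0 <= s ->
  series (fun k => digit_prob s k.+1) @ \oo --> (1 : R).
Proof.
move=> s0; rewrite (_ : series _ = fun n => 1 - (1 + s) / (n.+1%:R + s)).
  rewrite -[X in _ --> X](subr0 1).
  by apply: cvgB; [exact: cvg_cst|exact: cvg_inv_natS].
by apply/funext => n; rewrite /series/= sum_digit_prob.
Qed.

Lemma digit_exp_cvg s G : 0 <= s -> digit_bounded G ->
  cvgn (series (fun k => digit_prob s k.+1 * G k.+1)).
Proof.
move=> s0 [M HM]; apply: normed_cvg.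
apply: (@series_le_cvg _ _ (M *: (fun k => digit_prob s k.+1))) => [n|n|n|].
- exact: normr_ge0.
- by rewrite mulr_ge0 ?digit_prob_ge0// (le_trans (normr_ge0 _) (HM n.+1 _)).
- rewrite /= normrM ger0_norm ?digit_prob_ge0//.
  rewrite -[X in _ <= X]/(M * digit_prob s n.+1) mulrC.
  by rewrite ler_wpM2r ?digit_prob_ge0// HM.
- by apply: is_cvg_seriesZ; apply/cvg_ex; exists 1; exact: cvg_sum_digit_prob.
Qed.

Lemma digit_bounded_cst (c : R) : digit_bounded (fun=> c).
Proof. by exists `|c|. Qed.

Lemma digit_boundedD G H : digit_bounded G -> digit_bounded H ->
  digit_bounded (fun a => G a + H a).
Proof.
move=> [M HM] [N HN]; exists (M + N) => a a0.
by rewrite (le_trans (ler_normD _ _))// lerD ?HM ?HN.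
Qed.

Lemma digit_boundedM G H : digit_bounded G -> digit_bounded H ->
  digit_bounded (fun a => G a * H a).
Proof.
move=> [M HM] [N HN]; exists (M * N) => a a0.
by rewrite normrM ler_pM ?HM ?HN.
Qed.

Lemma digit_boundedZ (c : R) G : digit_bounded G -> digit_bounded (fun a => c * G a).
Proof. by apply: digit_boundedM; exact: digit_bounded_cst. Qed.

Lemma digit_boundedB G H : digit_bounded G -> digit_bounded H ->
  digit_bounded (fun a => G a - H a).
Proof.
move=> [M HM] [N HN]; exists (M + N) => a a0.
by rewrite (le_trans (ler_normB _ _))// lerD ?HM ?HN.
Qed.

Lemma digit_bounded_sqr G : digit_bounded G -> digit_bounded (fun a => G a ^+ 2).
Proof. by move=> bG; apply: digit_boundedM. Qed.

Lemma digit_bounded_itv (m M : R) G :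
  (forall a, (0 < a)%N -> m <= G a <= M) -> digit_bounded G.
Proof.
move=> HG; exists (`|m| + `|M|) => a a0.
have /andP[] := HG a a0; have := ler_norm M; have := ler_norm (- m).
rewrite normrN => h1 h2 h3 h4.
by rewrite ler_norml; have := normr_ge0 m; have := normr_ge0 M; lra.
Qed.

Lemma digit_bounded_eventually0 N G : (forall a, (N < a)%N -> G a = 0) ->
  digit_bounded G.
Proof.
move=> G0; exists (\sum_(0 <= i < N.+1) `|G i|) => a a0.
have [aN|Na] := leqP a N; last by rewrite G0// normr0 sumr_ge0.
rewrite big_mkord (bigD1 (Ordinal (aN : (a < N.+1)%N)))//=.
by rewrite lerDl sumr_ge0.
Qed.

Lemma eq_digit_exp s G H : (forall a, (0 < a)%N -> G a = H a) ->
  digit_exp s G = digit_exp s H.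
Proof.
move=> GH; rewrite /digit_exp; congr (limn (series _)).
by apply/funext => k; rewrite GH.
Qed.

Lemma digit_exp_cst s (c : R) : 0 <= s -> digit_exp s (fun=> c) = c.
Proof.
move=> s0; rewrite /digit_exp.
rewrite (_ : (fun k => _) = c *: (fun k => digit_prob s k.+1)); last first.
  by apply/funext => k /=; rewrite mulrC.
rewrite lim_seriesZ; last by apply/cvg_ex; exists 1; exact: cvg_sum_digit_prob.
by rewrite (cvg_lim _ (cvg_sum_digit_prob s0))//= /GRing.scale/= mulr1.
Qed.

Lemma digit_expD s G H : 0 <= s -> digit_bounded G -> digit_bounded H ->
  digit_exp s (fun a => G a + H a) = digit_exp s G + digit_exp s H.
Proof.
move=> s0 bG bH; rewrite /digit_exp -lim_seriesD; [|exact: digit_exp_cvg..].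
by congr (limn (series _)); apply/funext => k /=; rewrite mulrDr.
Qed.

Lemma digit_expZ s (c : R) G : 0 <= s -> digit_bounded G ->
  digit_exp s (fun a => c * G a) = c * digit_exp s G.
Proof.
move=> s0 bG; rewrite /digit_exp -[RHS]lim_seriesZ; last exact: digit_exp_cvg.
by congr (limn (series _)); apply/funext => k /=; rewrite mulrCA.
Qed.

Lemma digit_expB s G H : 0 <= s -> digit_bounded G -> digit_bounded H ->
  digit_exp s (fun a => G a - H a) = digit_exp s G - digit_exp s H.
Proof.
move=> s0 bG bH; rewrite /digit_exp -lim_seriesB; [|exact: digit_exp_cvg..].
by congr (limn (series _)); apply/funext => k /=; rewrite mulrBr.
Qed.

Lemma digit_exp_le s G H : 0 <= s -> digit_bounded G -> digit_bounded H ->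
  (forall a, (0 < a)%N -> G a <= H a) -> digit_exp s G <= digit_exp s H.
Proof.
move=> s0 bG bH GH; apply: lim_series_le; [exact: digit_exp_cvg..|].
by move=> n; rewrite ler_wpM2l ?digit_prob_ge0// GH.
Qed.

Lemma digit_exp_ge0 s G : 0 <= s -> digit_bounded G ->
  (forall a, (0 < a)%N -> 0 <= G a) -> 0 <= digit_exp s G.
Proof.
move=> s0 bG G0; rewrite -(digit_exp_cst 0 s0).
by apply: digit_exp_le => //; exact: digit_bounded_cst.
Qed.

Lemma digit_exp_itv s (m M : R) G : 0 <= s ->
  (forall a, (0 < a)%N -> m <= G a <= M) -> m <= digit_exp s G <= M.
Proof.
move=> s0 HG; have bG := digit_bounded_itv HG.
apply/andP; split; [rewrite -(digit_exp_cst m s0)|rewrite -(digit_exp_cst M s0)];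
  apply: digit_exp_le => //; try exact: digit_bounded_cst;
  by move=> a /HG /andP[].
Qed.

(** Nonnegativity of the variance: the mean of [(G a - e) ^+ 2] is expanded. *)
Lemma digit_exp_sqr s G : 0 <= s -> digit_bounded G ->
  digit_exp s G ^+ 2 <= digit_exp s (fun a => G a ^+ 2).
Proof.
move=> s0 bG; set e := digit_exp s G.
have bG2 := digit_bounded_sqr bG.
have be : digit_bounded (fun a => (2 * e) * G a) by apply: digit_boundedZ.
have := @digit_exp_ge0 s (fun a => (G a ^+ 2 - (2 * e) * G a) + e ^+ 2) s0.
have bB := digit_boundedB bG2 be; have bc := digit_bounded_cst (e ^+ 2).
rewrite digit_expD// digit_expB// digit_expZ// digit_exp_cst//.
rewrite -/e => h; suff : 0 <= digit_exp s (fun a => G a ^+ 2) - 2 * e * e + e ^+ 2.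
  by nra.
apply: h => [|a _]; first exact: digit_boundedD.
by rewrite (_ : _ + _ = (G a - e) ^+ 2) ?sqr_ge0//; ring.
Qed.

Lemma digit_exp_finite s N G : (forall a, (N < a)%N -> G a = 0) ->
  digit_exp s G = \sum_(1 <= a < N.+1) digit_prob s a * G a.
Proof.
move=> G0; rewrite /digit_exp; apply/cvg_lim => //.
apply: cvg_near_cst; near=> n.
have Nn : (N <= n)%N by near: n; exact: nbhs_infty_ge.
rewrite /series/= (big_cat_nat (leq0n N) Nn)//= [X in _ + X]big1_seq ?addr0.
  by rewrite big_add1.
move=> k /andP[_]; rewrite mem_index_iota => /andP[Nk _].
by rewrite G0 ?mulr0.
Unshelve. all: end_near. Qed.

End DigitExpectation.

(** * Transfer operator *)

(** The Gauss-Kuzmin-Wirsing operator conjugated by the density [1 / (1 + s)], hence an averaging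
    operator that fixes constants. *)
Definition transfer {R : realType} (h : R -> R) (s : R) : R :=
  digit_exp s (fun a => h (a%:R + s)^-1).

(* The transfer operator maps this weight to [1 / (2 * (2 + s))] by telescoping. *)
Definition weight {R : realType} (s : R) : R := s / (1 + 2 * s).

(** Equivalently, [K * weight + h] and [K * weight - h] are both nondecreasing on [[0, 1]], the form
    on which [transfer] acts. *)
Definition weight_lip {R : realType} (K : R) (h : R -> R) : Prop :=
  forall s t, 0 <= s -> s <= t -> t <= 1 -> `|h t - h s| <= K * (weight t - weight s).

Section Transfer.
Variable R : realType.
Implicit Types (s t x K : R) (h : R -> R) (G : nat -> R) (a n N : nat).

Lemma inv_digit_itv s a : 0 <= s -> (0 < a)%N -> 0 <= (a%:R + s)^-1 <= 1.
Proof.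
move=> s0 a0; have a1 : 1 <= a%:R :> R by rewrite ler1n.
have d1 : 1 <= a%:R + s by lra.
by rewrite invr_ge0 invf_le1 ?(lt_le_trans ltr01)// d1 (le_trans ler01).
Qed.

Lemma digit_bounded_inv (m M : R) h s : 0 <= s ->
  (forall t, 0 <= t <= 1 -> m <= h t <= M) ->
  digit_bounded (fun a => h (a%:R + s)^-1).
Proof.
move=> s0 hb; apply: (digit_bounded_itv (m := m) (M := M)) => a a0.
exact/hb/inv_digit_itv.
Qed.

(* The digit is stochastically increasing in [s]. *)
Lemma digit_exp_antitone s t G : 0 <= s -> s <= t -> digit_bounded G ->
  (forall a, (0 < a)%N -> 0 <= G a) ->
  (forall a, (0 < a)%N -> G a.+1 <= G a) -> digit_exp t G <= digit_exp s G.
Proof.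
move=> s0 st bG G0 Gdec; have t0 : 0 <= t by lra.
rewrite /digit_exp; apply: ler_lim; [exact: digit_exp_cvg..|].
apply: nearW => n; rewrite -subr_ge0 /series/=.
(* Abel summation: the partial sums of the law at [s] dominate those at [t] and [G] decreases, so
   the difference is at least a nonnegative boundary term. *)
suff : (\sum_(0 <= k < n) digit_prob s k.+1 - \sum_(0 <= k < n) digit_prob t k.+1)
    * G n.+1 <= \sum_(0 <= k < n) digit_prob s k.+1 * G k.+1 -
        \sum_(0 <= k < n) digit_prob t k.+1 * G k.+1.
  apply: le_trans; rewrite mulr_ge0 ?G0// !sum_digit_prob//.
  have n1 : 1 <= n.+1%:R :> R by rewrite ler1n.
  have -> : forall u v : R, 1 - u - (1 - v) = v - u by move=> u v; ring.
  rewrite subr_ge0 ler_pdivrMr; last lra.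
  by rewrite mulrAC ler_pdivlMr; [nra|lra].
elim: n => [|n IH]; first by rewrite !big_geq// subrr mul0r.
rewrite !big_nat_recr//=.
set A := \sum_(0 <= k < n) _ in IH *; set B := \sum_(0 <= k < n) _ in IH *.
set C := \sum_(0 <= k < n) _ in IH *; set D := \sum_(0 <= k < n) _ in IH *.
have AB : 0 <= A + digit_prob s n.+1 - (B + digit_prob t n.+1).
  have E u : 0 <= u -> \sum_(0 <= k < n) digit_prob u k.+1 + digit_prob u n.+1 =
      1 - (1 + u) / (n.+2%:R + u).
    by move=> u0; rewrite -sum_digit_prob// big_nat_recr.
  rewrite !E//.
  have n1 : 1 <= n.+2%:R :> R by rewrite ler1n.
  have -> : forall u v : R, 1 - u - (1 - v) = v - u by move=> u v; ring.
  rewrite subr_ge0 ler_pdivrMr; last lra.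
  by rewrite mulrAC ler_pdivlMr; [nra|lra].
have := ler_wpM2l AB (Gdec n.+1 isT).
lra.
Qed.

Lemma transfer_antitone h s t :
  (forall s t, 0 <= s -> s <= t -> t <= 1 -> h s <= h t) ->
  0 <= s -> s <= t -> t <= 1 -> transfer h t <= transfer h s.
Proof.
move=> hh s0 st t1; have t0 : 0 <= t by lra.
have hb u : 0 <= u <= 1 -> h 0 <= h u <= h 1.
  by move=> /andP[u0 u1]; rewrite !hh.
have bs := digit_bounded_inv s0 hb; have bt := digit_bounded_inv t0 hb.
(* The state moves from [s] to [t] in two stages: here inside [h], then in the law of the digit. *)
have le1 : digit_exp s (fun a => h (a%:R + t)^-1) <= transfer h s.
  apply: digit_exp_le => // a a0; have a1 : 1 <= a%:R :> R by rewrite ler1n.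
  have /andP[? ?] := inv_digit_itv s0 a0; have /andP[? ?] := inv_digit_itv t0 a0.
  by apply: hh => //; rewrite lef_pV2 ?posrE; lra.
apply: le_trans le1.
have bc := digit_bounded_cst (h 0).
(* Subtracting [h 0] yields the nonnegative function that [digit_exp_antitone] asks for. *)
have E u : 0 <= u -> digit_exp u (fun a => h (a%:R + t)^-1) =
    digit_exp u (fun a => h (a%:R + t)^-1 - h 0) + h 0.
  by move=> u0; rewrite digit_expB// digit_exp_cst// subrK.
rewrite /transfer !E// lerD2r; apply: digit_exp_antitone => //.
- exact: digit_boundedB.
- by move=> a a0; rewrite subr_ge0; have /andP[] := hb _ (inv_digit_itv t0 a0).
- move=> a a0; rewrite lerD2r; have a1 : 1 <= a%:R :> R by rewrite ler1n.
  have /andP[? _] := inv_digit_itv t0 (ltn0Sn a).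
  have /andP[_ ?] := inv_digit_itv t0 a0.
  by apply: hh => //; rewrite lef_pV2 ?posrE -?natr1; lra.
Qed.

Lemma weight_itv s : 0 <= s -> 0 <= weight s <= 1.
Proof.
move=> s0; rewrite /weight divr_ge0//=; last lra.
by rewrite ler_pdivrMr; lra.
Qed.

Lemma weightB s t : 0 <= s -> 0 <= t ->
  weight t - weight s = (t - s) / ((1 + 2 * s) * (1 + 2 * t)).
Proof. by move=> s0 t0; rewrite /weight; field; rewrite !gt_eqF//; lra. Qed.

Lemma weight_le s t : 0 <= s -> s <= t -> weight s <= weight t.
Proof.
move=> s0 st; rewrite -subr_ge0 weightB//; last lra.
by rewrite divr_ge0//; [lra|rewrite mulr_ge0//; lra].
Qed.

(** Since [weight (1 / y) = 1 / (y + 2)], the term at [y = a + s] is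
    [(1 + s) / (y (y + 1) (y + 2))], half the increment of [(1 + s) / (y (y + 1))], up to sign. *)
Lemma transfer_weight s : 0 <= s -> transfer weight s = (2 * (2 + s))^-1.
Proof.
move=> s0; apply/cvg_lim => //.
rewrite (_ : series _ = fun n => (2 * (2 + s))^-1 -
  (1 + s) / (n.+1%:R + s) * ((1 + (s + 1)) / (n.+1%:R + (s + 1))) * (2 * (2 + s))^-1).
  have c1 := cvg_inv_natS s0; have s1 : 0 <= s + 1 by lra.
  have c2 := cvg_inv_natS s1; pose k := (2 * (2 + s))^-1.
  have := cvgB (cvg_cst k) (cvgM (cvgM c1 c2) (cvg_cst k)).
  by rewrite !mul0r subr0; apply.
apply/funext => n; rewrite /series/=; elim: n => [|n IH].
  by rewrite big_geq//; field; rewrite !gt_eqF//; lra.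
have n0 : 0 <= n%:R :> R by [].
rewrite big_nat_recr//= IH /digit_prob /weight -!natr1.
by field; rewrite !gt_eqF//; lra.
Qed.

Lemma weight_lip_ge0 K h : weight_lip K h -> 0 <= K.
Proof.
move=> /(_ 0 1 (lexx 0) ler01 (lexx 1)) /(le_trans (normr_ge0 _)).
by rewrite weightB//= pmulr_lge0// divr_gt0// !mulr_gt0//; lra.
Qed.

Lemma weight_lip_bounded K h t : weight_lip K h -> 0 <= t <= 1 ->
  h 0 - K <= h t <= h 0 + K.
Proof.
move=> hK /andP[t0 t1]; have K0 := weight_lip_ge0 hK.
have := hK 0 t (lexx 0) t0 t1.
have /andP[? ?] := weight_itv t0.
rewrite ler_norml {2 4}/weight mul0r subr0 => /andP[? ?].
by apply/andP; split; nra.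
Qed.

Lemma digit_bounded_weight_lip K h s : weight_lip K h -> 0 <= s ->
  digit_bounded (fun a => h (a%:R + s)^-1).
Proof.
move=> hK s0; apply: digit_bounded_inv => // t t01.
exact: (weight_lip_bounded hK t01).
Qed.

(** Applying [transfer_antitone] to [K * weight + h] and [K * weight - h] bounds the change of
    [transfer h] by [K] times the decrease of [transfer weight]. *)
Lemma weight_lip_transfer K h : weight_lip K h -> weight_lip (K / 2) (transfer h).
Proof.
move=> hK s t s0 st t1; have K0 := weight_lip_ge0 hK; have t0 : 0 <= t by lra.
have bh u : 0 <= u -> digit_bounded (fun a => h (a%:R + u)^-1).
  by move=> u0; exact: (digit_bounded_weight_lip hK).
have bw u : 0 <= u -> digit_bounded (fun a => K * weight (a%:R + u)^-1).
  move=> u0; apply: digit_boundedZ; apply: (@digit_bounded_inv 0 1) => // v.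
  by move=> /andP[v0 _]; exact: weight_itv.
have bw' u : 0 <= u -> digit_bounded (fun a => weight (a%:R + u)^-1 : R).
  move=> u0; apply: (@digit_bounded_inv 0 1) => // v.
  by move=> /andP[v0 _]; exact: weight_itv.
have Ep u : 0 <= u -> transfer (fun v => K * weight v + h v) u =
    K * (2 * (2 + u))^-1 + transfer h u.
  move=> u0; rewrite /transfer digit_expD//; [|exact: bw|exact: bh].
  by rewrite digit_expZ//; [rewrite -transfer_weight|exact: bw'].
have Em u : 0 <= u -> transfer (fun v => K * weight v - h v) u =
    K * (2 * (2 + u))^-1 - transfer h u.
  move=> u0; rewrite /transfer digit_expB//; [|exact: bw|exact: bh].
  by rewrite digit_expZ//; [rewrite -transfer_weight|exact: bw'].
have P : transfer (fun v => K * weight v + h v) t <=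
         transfer (fun v => K * weight v + h v) s.
  apply: transfer_antitone => // u v u0 uv v1.
  by have := hK u v u0 uv v1; rewrite ler_norml => /andP[]; lra.
have M : transfer (fun v => K * weight v - h v) t <=
         transfer (fun v => K * weight v - h v) s.
  apply: transfer_antitone => // u v u0 uv v1.
  by have := hK u v u0 uv v1; rewrite ler_norml => /andP[]; lra.
rewrite !Ep// in P; rewrite !Em// in M.
(* Here [1 + 2 s <= 2 + s] for [s <= 1], and likewise for [t]. *)
have W : (2 * (2 + s))^-1 - (2 * (2 + t))^-1 <= (weight t - weight s) / 2.
  rewrite weightB// (_ : _ - _ = (t - s) / (2 * (2 + s) * (2 + t))); last first.
    by field; rewrite !gt_eqF//; lra.
  rewrite -[X in _ <= X]mulrA -[X in _ <= _ * X]invfM ler_wpM2l//; first lra.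
  by rewrite lef_pV2 ?posrE; nra.
have := ler_wpM2l K0 W.
by rewrite ler_norml => KW; apply/andP; split; lra.
Qed.

Lemma digit_tailE s N : 0 <= s ->
  digit_exp s (fun a => (N < a)%N%:R) = (1 + s) / (N.+1%:R + s).
Proof.
move=> s0.
have b1 : digit_bounded (fun=> 1 : R) by exact: digit_bounded_cst.
have b2 : digit_bounded (fun a => (a <= N)%N%:R : R).
  by apply: (digit_bounded_eventually0 (N := N)) => a; rewrite ltnNge => /negbTE ->.
rewrite (@eq_digit_exp _ _ _ (fun a => 1 - (a <= N)%N%:R)); last first.
  by move=> a _; rewrite ltnNge; case: (a <= N)%N; rewrite /= ?subrr ?subr0.
rewrite digit_expB// digit_exp_cst// (@digit_exp_finite _ _ N); last first.
  by move=> a; rewrite ltnNge => /negbTE ->.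
rewrite (_ : \sum_(1 <= a < N.+1) _ = \sum_(0 <= k < N) digit_prob s k.+1).
  by rewrite sum_digit_prob//; lra.
rewrite big_add1 [LHS]big_nat [RHS]big_nat; apply: eq_bigr => i /andP[_ iN].
by rewrite iN mulr1.
Qed.

Lemma digit_tail_le s x : 0 <= s <= 1 -> 0 < x ->
  digit_exp s (fun a => (x < a%:R)%R%:R) <= 2 / x.
Proof.
move=> /andP[s0 s1] x0.
rewrite (@eq_digit_exp _ _ _ (fun a => (Num.truncn x < a)%N%:R)); last first.
  by move=> a _; rewrite truncn_lt_nat// ltW.
rewrite digit_tailE//; have := truncnS_gt x => xN.
by rewrite ler_pM// ?invr_ge0 ?lef_pV2 ?posrE//; lra.
Qed.

End Transfer.

(** * Lebesgue measure of unions of cylinders *)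

(** Recursion on the first digit lets the estimates on words go by induction through
    [word_prob_step]. *)
Fixpoint word_prob {R : realType} (n : nat) (s : R) (A : pred (seq nat)) : R :=
  if n is m.+1 then
    digit_exp s (fun a => word_prob m (a%:R + s)^-1 (fun w => A (a :: w)))
  else (A [::])%:R.

(* The points [(p + p' t) / (q + q' t)] whose [t] has its first [n] digits in [A];
   intervals are closed, so shared endpoints are counted twice. *)
Fixpoint cylinders {R : realType} (n : nat) (p q p' q' : R) (A : pred (seq nat))
    : set R :=
  if n is m.+1 then
    \bigcup_k cylinders m (p * k.+1%:R + p') (q * k.+1%:R + q') p q
      (fun w => A (k.+1 :: w))
  else if A [::] then
    `[Num.min (p / q) ((p + p') / (q + q')),
      Num.max (p / q) ((p + p') / (q + q'))]%classic
  else set0.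

Section WordProb.
Variable R : realType.
Implicit Types (s p q : R) (A : pred (seq nat)).

Lemma word_prob_itv n s A : 0 <= s -> 0 <= word_prob n s A <= 1.
Proof.
elim: n s A => [|n IH] s A s0 /=; first by case: (A _); rewrite lexx ler01.
apply: digit_exp_itv => // a a0; apply: IH.
by have /andP[] := inv_digit_itv s0 a0.
Qed.

Lemma digit_bounded_word_prob n s (B : nat -> pred (seq nat)) : 0 <= s ->
  digit_bounded (fun a => word_prob n (a%:R + s)^-1 (B a)).
Proof.
move=> s0; apply: (digit_bounded_itv (m := 0) (M := 1)) => a a0.
by apply: word_prob_itv; have /andP[] := inv_digit_itv s0 a0.
Qed.

Lemma word_prob_step n s A G : 0 <= s -> digit_bounded G ->
  (forall a, (0 < a)%N ->
    word_prob n (a%:R + s)^-1 (fun w => A (a :: w)) <= G a) ->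
  word_prob n.+1 s A <= digit_exp s G.
Proof.
by move=> s0 bG le; apply: digit_exp_le => //; exact: digit_bounded_word_prob.
Qed.

Lemma measurable_cylinders n p q p' q' A : measurable (cylinders n p q p' q' A).
Proof.
elim: n p q p' q' A => [|n IH] p q p' q' A /=.
  by case: (A _); [exact: measurable_itv|exact: measurable0].
by apply: bigcup_measurable => k _; exact: IH.
Qed.

Lemma nneseries_EFin (u : nat -> R) : cvgn (series u) ->
  (\sum_(0 <= k <oo) (u k)%:E)%E = (limn (series u))%:E.
Proof.
move=> cu; rewrite -EFin_lim//; congr (limn _); apply/funext => n /=.
by rewrite /series/= sumEFin.
Qed.

(** For consecutive convergents [p' / q'] and [p / q] the base interval has length
    [1 / (q (q + q'))], by the determinant, and fixing the next digit [a] multiplies it by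
    [digit_prob (q' / q) a]. The unions are handled by subadditivity. *)
Lemma cylinders_measure n p q p' q' A : 0 < q -> 0 <= q' ->
  `|p * q' - p' * q| = 1 ->
  (@lebesgue_measure R (cylinders n p q p' q' A) <=
    (word_prob n (q' / q) A / (q * (q + q')))%:E)%E.
Proof.
elim: n p q p' q' A => [|n IH] p q p' q' A q0 q'0 D /=.
  case: (A _); last by rewrite measure0 mul0r.
  rewrite lebesgue_measure_itv/= lte_fin; case: ifPn => [_|_]; last first.
    by rewrite lee_fin mul1r invr_ge0 mulr_ge0//; lra.
  rewrite -EFinB lee_fin.
  have -> : (1 : R) / (q * (q + q')) = `|p / q - (p + p') / (q + q')|.
    rewrite (_ : _ - _ = (p * q' - p' * q) / (q * (q + q'))); last first.
      by field; rewrite !gt_eqF//; lra.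
    rewrite normrM D normfV ger0_norm// mulr_ge0//; lra.
  rewrite /Num.min /Num.max; case: ltP => h.
    by rewrite ltr0_norm ?subr_lt0// opprB.
  by rewrite ger0_norm ?subr_ge0.
have s0 : 0 <= q' / q by rewrite divr_ge0// ltW.
apply: le_trans.
  apply: generalized_Boole_inequality => [k|]; first exact: measurable_cylinders.
  by apply: bigcup_measurable => k _; exact: measurable_cylinders.
pose G a : R := word_prob n (a%:R + q' / q)^-1 (fun w => A (a :: w)).
have bG : digit_bounded G by exact: digit_bounded_word_prob.
have -> : ((digit_exp (q' / q) G / (q * (q + q')))%:E =
  \sum_(0 <= k <oo) ((q * (q + q'))^-1 * (digit_prob (q' / q) k.+1 * G k.+1))%:E)%E.
  rewrite nneseries_EFin; last exact/is_cvg_seriesZ/digit_exp_cvg.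
  by rewrite lim_seriesZ; [rewrite mulrC|exact: digit_exp_cvg].
apply: lee_nneseries => k _ //=.
have k0 : 0 <= k%:R :> R by [].
have qk : 0 < q * k.+1%:R + q' by rewrite -natr1; nra.
apply: le_trans (IH _ _ _ _ _ qk (ltW q0) _) _.
  (* Appending a digit reverses the sign of the determinant, hence the absolute value in the
     hypothesis. *)
  rewrite -[RHS]D -normrN; congr (`|_|); ring.
rewrite lee_fin /G /digit_prob -!natr1 (_ : q / _ = (k%:R + 1 + q' / q)^-1).
  rewrite le_eqVlt; apply/orP; left; apply/eqP.
  by field; rewrite -natr1 in qk; rewrite !gt_eqF//; nra.
by field; rewrite -natr1 in qk; rewrite !gt_eqF//; nra.
Qed.

(** Here [t i] is the tail starting at digit [i]; replacing it by [1 / (a i + t (i + 1))] writes the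
    same point over the next pair of convergents. *)
Lemma mem_cylinders (a : nat -> nat) (t : nat -> R) n i p q p' q' A :
  (forall j, (i <= j)%N ->
    [/\ (0 < a j)%N, 0 <= t j <= 1 & t j = ((a j)%:R + t j.+1)^-1]) ->
  0 < q -> 0 <= q' -> A [seq a j | j <- iota i n] ->
  cylinders n p q p' q' A ((p + p' * t i) / (q + q' * t i)).
Proof.
elim: n i p q p' q' A => [|n IH] i p q p' q' A at0 q0 q'0 /=.
  move=> ->; have [_ /andP[t0 t1] _] := at0 i (leqnn i).
  rewrite /= in_itv/=; apply/andP; split.
    (* The sign of the determinant decides which endpoint is the smaller one. *)
    rewrite ge_min; case: (leP 0 (p' * q - p * q')) => h; apply/orP; [left|right].
    - rewrite ler_pdivrMr// mulrAC ler_pdivlMr; nra.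
    - rewrite ler_pdivrMr; last nra.
      by rewrite mulrAC ler_pdivlMr; nra.
  rewrite le_max; case: (leP 0 (p' * q - p * q')) => h; apply/orP; [right|left].
    - rewrite ler_pdivrMr; last nra.
      by rewrite mulrAC ler_pdivlMr; nra.
    - rewrite ler_pdivrMr; last nra.
      by rewrite mulrAC ler_pdivlMr; nra.
move=> hA; have [a0 /andP[t0 t1] tE] := at0 i (leqnn i).
have [_ /andP[u0 u1] _] := at0 i.+1 (leqnSn i).
have a1 : 1 <= (a i)%:R :> R by rewrite ler1n.
exists (a i).-1 => //; rewrite prednK//.
have -> : (p + p' * t i) / (q + q' * t i) =
  ((p * (a i)%:R + p') + p * t i.+1) / ((q * (a i)%:R + q') + q * t i.+1).
  by rewrite tE; field; rewrite !gt_eqF//; nra.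
apply: IH => //; [by move=> j ij; apply: at0; exact: ltnW|nra|exact: ltW].
Qed.

End WordProb.

(** * Invariance of the Gauss measure *)

(** Left without the factor [1 / ln 2], so that [1 + s] has integral 1. *)
Definition gauss_integral {R : realType} (h : R -> R) : \bar R :=
  (\int[@lebesgue_measure R]_(x in `[0%R, 1%R]) (h x / (1 + x))%:E)%E.

Section GaussIntegral.
Variable R : realType.
Implicit Types (h : R -> R) (M : R).
Local Notation mu := (@lebesgue_measure R).

Lemma is_derive_inv_shift (c x : R) : 0 < c + x ->
  is_derive x 1 (fun s : R => (c + s)^-1) (- (c + x) ^- 2).
Proof.
move=> cx0; have cx : c + x != 0 by rewrite gt_eqF.
have d : is_derive x 1 (fun s => c + s) 1.
  by rewrite -[X in is_derive _ _ _ X]add0r; apply: is_deriveD.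
have := @is_deriveV _ (fun s => c + s) x 1 1 cx d.
by rewrite /GRing.scale/= mulr1.
Qed.

Lemma continuous_inv_shift (c x : R) : 0 < c + x ->
  {for x, continuous (fun s : R => (c + s)^-1)}.
Proof.
move=> cx; apply: differentiable_continuous.
by apply/derivable1_diffP; have [] := is_derive_inv_shift cx.
Qed.

Lemma within_continuous_measurable (a b : R) (f : R -> R) :
  {in `[a, b], continuous f} -> measurable_fun `[a, b] (fun x => (f x)%:E).
Proof.
move=> cf; apply/measurable_EFinP; apply: subspace_continuous_measurable_fun => //.
by apply: continuous_in_subspaceT => x; rewrite inE; exact: cf.
Qed.

Lemma continuous_gauss_integrand h (x : R) : continuous h -> 0 <= x ->
  {for x, continuous (fun x : R => h x / (1 + x))}.
Proof.
move=> ch x0; apply: continuousM; first exact: ch.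
by apply: continuous_inv_shift; lra.
Qed.

(** Substitution [x = 1 / (k + 1 + y)]: up to sign, [dx / (1 + x)] becomes
    [dy / ((k + 1 + y) (k + 2 + y))]. *)
Lemma integral_gauss_branch h k : continuous h ->
  (\int[mu]_(x in `[k.+2%:R^-1%R, k.+1%:R^-1%R]) (h x / (1 + x))%:E =
   \int[mu]_(x in `[0%R, 1%R]) (h (k.+1%:R + x)^-1 /
      ((k.+1%:R + x) * (k.+1%:R + x + 1)))%:E)%E.
Proof.
move=> ch; pose F s : R := (k.+1%:R + s)^-1.
have k1 : 1 <= k.+1%:R :> R by rewrite ler1n.
have dF (x : R) : 0 <= x -> is_derive x 1 F (- (k.+1%:R + x) ^- 2).
  by move=> x0; apply: is_derive_inv_shift; lra.
have F'E (x : R) : 0 <= x -> derive1 F x = - (k.+1%:R + x) ^- 2.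
  by move=> x0; rewrite derive1E; have [_ ->] := dF x x0.
have cF (x : R) : 0 <= x -> {for x, continuous F}.
  by move=> x0; apply: continuous_inv_shift; lra.
have cF'' (x : R) : 0 <= x -> {for x, continuous (fun y : R => - (k.+1%:R + y) ^- 2 : R)}.
  move=> x0; apply: continuousN; rewrite (_ : (fun x => _) = (F \* F)).
    by apply: continuousM; exact: cF.
  by apply/funext => y; rewrite /F /= -invfM expr2.
have -> : k.+2%:R^-1 = F 1 by rewrite /F natr1.
have -> : k.+1%:R^-1 = F 0 by rewrite /F addr0.
have Fnear (x : R) : 0 < x -> \forall y \near x, - (k.+1%:R + y) ^- 2 = derive1 F y.
  move=> x0; near=> y; rewrite F'E// ltW//; near: y; exact: lt_nbhsr.
rewrite (@integration_by_substitution_decreasing _ F)//.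
- apply: eq_integral => x; rewrite inE/= in_itv/= => /andP[x0 x1].
  congr (_%:E); rewrite !fctE F'E// /F /= opprK.
  by field; rewrite !gt_eqF//; lra.
- move=> x y; rewrite !in_itv/= => /andP[x0 x1] /andP[y0 y1] yx.
  by rewrite /F ltf_pV2 ?posrE; lra.
- move=> x; rewrite in_itv/= => /andP[x0 x1].
  rewrite /prop_for /continuous_at F'E ?ltW//.
  apply: cvg_trans (cF'' x (ltW x0)).
  by apply: near_eq_cvg; exact: Fnear.
- apply/cvg_ex; exists (- (k.+1%:R + 0) ^- 2).
  apply: cvg_trans (cvg_at_right_filter (cF'' 0 (lexx 0))).
  by apply: near_eq_cvg; near=> y; rewrite F'E.
- apply/cvg_ex; exists (- (k.+1%:R + 1) ^- 2).
  apply: cvg_trans (cvg_at_left_filter (cF'' 1 ler01)).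
  apply: near_eq_cvg; near=> y; rewrite F'E//.
  by near: y; apply: nbhs_left_ge.
- split.
  + by move=> x; rewrite in_itv/= => /andP[x0 x1]; have [] := dF x (ltW x0).
  + by apply: cvg_at_right_filter; exact: cF.
  + by apply: cvg_at_left_filter; exact: cF.
- apply: continuous_in_subspaceT => x; rewrite inE/= in_itv/= => /andP[x0 _].
  apply: continuous_gauss_integrand => //; apply: le_trans x0.
  by rewrite invr_ge0; lra.
Unshelve. all: end_near. Qed.

Lemma bigcup_gauss_branches :
  \bigcup_k `]k.+2%:R^-1, k.+1%:R^-1]%classic = `]0, 1]%classic :> set R.
Proof.
apply/seteqP; split => [x [k _]|x] /=; rewrite !in_itv/= => /andP[x0 x1].
  rewrite (lt_le_trans _ (ltW x0)) ?invr_gt0//=.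
  by rewrite (le_trans x1)// invf_le1// ler1n.
have xV : 1 <= x^-1 by rewrite invf_ge1.
have := truncn_itv (le_trans ler01 xV); set N := Num.truncn _.
have N0 : (0 < N)%N by rewrite truncn_gt0.
move=> /andP[h1 h2]; exists N.-1 => //=; rewrite in_itv/= prednK//.
have N0' : 0 < N%:R :> R by rewrite ltr0n.
rewrite -[x]invrK ltf_pV2 ?posrE ?invr_gt0// h2/=.
by rewrite lef_pV2 ?posrE ?invr_gt0.
Qed.

Lemma trivIset_gauss_branches :
  trivIset setT (fun k => `]k.+2%:R^-1, k.+1%:R^-1]%classic : set R).
Proof.
apply/trivIsetP => i j _ _ ij.
wlog lt_ij : i j ij / (i < j)%N.
  move=> H; have [|ji|e] := ltngtP i j; [exact: H|rewrite setIC; apply: H => //|].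
    by rewrite eq_sym.
  by rewrite e eqxx in ij.
apply/seteqP; split => // x [] /=; rewrite !in_itv/= => /andP[h1 _] /andP[_ h2].
have : (j.+1%:R^-1 : R) <= i.+2%:R^-1 by rewrite lef_pV2 ?posrE// ler_nat.
by move=> /(le_trans h2) /(lt_le_trans h1); rewrite ltxx.
Qed.

(** The density [1 / (1 + x)] cancels the numerator of [digit_prob x a], so the term of digit [a] is
    the integral of [h] over the branch from [1 / (a + 1)] to [1 / a]; the branches fill []0, 1]].
    Nonnegativity permits exchanging sum and integral. *)
Lemma gauss_integral_transfer h M : continuous h ->
  (forall x : R, 0 <= x <= 1 -> 0 <= h x <= M) ->
  gauss_integral (transfer h) = gauss_integral h.
Proof.
move=> ch hM; rewrite /gauss_integral.
pose g k x : R := h (k.+1%:R + x)^-1 / ((k.+1%:R + x) * (k.+1%:R + x + 1)).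
have kx k (x : R) : 0 <= x -> 1 <= k.+1%:R + x.
  have k1 : 1 <= k.+1%:R :> R by rewrite ler1n.
  by move=> x0; lra.
transitivity (\int[mu]_(x in `[0%R, 1%R]) \sum_(0 <= k <oo) (g k x)%:E)%E.
  apply: eq_integral => x; rewrite inE/= in_itv/= => /andP[x0 x1].
  have bh : digit_bounded (fun a => h (a%:R + x)^-1) by exact: digit_bounded_inv hM.
  transitivity (\sum_(0 <= k <oo) ((1 + x)^-1 *
      (digit_prob x k.+1 * h (k.+1%:R + x)^-1))%:E)%E; last first.
    apply: eq_eseriesr => k _; congr (_%:E); rewrite /g /digit_prob.
    by have k1 := kx k x x0; field; rewrite !gt_eqF//; lra.
  have cs := digit_exp_cvg x0 bh.
  rewrite nneseries_EFin; last exact: is_cvg_seriesZ cs.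
  by rewrite (lim_seriesZ _ cs) mulrC.
have cg k (x : R) : 0 <= x -> {for x, continuous (g k)}.
  move=> x0; have := kx k x x0 => k1.
  have cF : {for x, continuous (fun s : R => (k.+1%:R + s)^-1)}.
    by apply: continuous_inv_shift; lra.
  have cF' : {for x, continuous (fun s : R => (k.+1%:R + 1 + s)^-1)}.
    by apply: continuous_inv_shift; lra.
  rewrite (_ : g k = (fun s : R => h (k.+1%:R + s)^-1) \*
      ((fun s : R => (k.+1%:R + s)^-1) \* (fun s : R => (k.+1%:R + 1 + s)^-1))).
    apply: continuousM; last exact: continuousM.
    by apply: continuous_comp => //; exact: ch.
  by apply/funext => s; rewrite /g/= -invfM (addrAC k.+1%:R 1 s).
rewrite integral_nneseries//; last 2 first.
- move=> k; apply: within_continuous_measurable => x.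
  by rewrite in_itv/= => /andP[x0 _]; exact: cg.
- move=> k x; rewrite /= in_itv/= => /andP[x0 x1].
  have := kx k x x0 => k1; rewrite lee_fin divr_ge0//; last first.
    by rewrite mulr_ge0//; lra.
  by have /andP[] := hM _ (inv_digit_itv x0 (ltn0Sn k)).
transitivity (\sum_(0 <= k <oo)
    \int[mu]_(x in `]k.+2%:R^-1%R, k.+1%:R^-1%R]) (h x / (1 + x))%:E)%E.
  apply: eq_eseriesr => k _; rewrite -integral_gauss_branch//.
  rewrite integral_itv_obnd_cbnd//.
  apply: (measurable_funS (measurable_itv `[k.+2%:R^-1, k.+1%:R^-1])).
    by apply: subset_itvr; rewrite bnd_simp.
  apply: within_continuous_measurable => x; rewrite in_itv/= => /andP[x0 _].
  by apply: continuous_gauss_integrand => //; apply: le_trans x0; rewrite invr_ge0.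
have m01 : measurable_fun (`]0, 1]%classic : set R) (fun x : R => (h x / (1 + x))%:E).
  apply: (measurable_funS (measurable_itv `[0, 1])).
    by apply: subset_itvr; rewrite bnd_simp.
  apply: within_continuous_measurable => x; rewrite in_itv/= => /andP[x0 _].
  exact: continuous_gauss_integrand.
rewrite -ge0_integral_bigcup//.
- by rewrite bigcup_gauss_branches integral_itv_obnd_cbnd.
- by rewrite bigcup_gauss_branches.
- move=> x; rewrite bigcup_gauss_branches/= in_itv/= => /andP[x0 x1].
  have /hM /andP[hx _] : 0 <= x <= 1 by rewrite ltW.
  by rewrite lee_fin divr_ge0//; lra.
- exact: trivIset_gauss_branches.
Qed.

End GaussIntegral.

(** * Sums of iterates of the transfer operator *)

Fixpoint transfer_sum {R : realType} (f : R -> R) (n : nat) (s : R) : R :=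
  if n is m.+1 then f s + transfer (transfer_sum f m) s else 0.

Section TransferSum.
Variable R : realType.
Implicit Types (f g h : R -> R) (s t x y K M c : R) (n : nat).
Local Notation mu := (@lebesgue_measure R).

Lemma weight_lipD f g K M : weight_lip K f -> weight_lip M g ->
  weight_lip (K + M) (fun s => f s + g s).
Proof.
move=> fK gM s t s0 st t1; rewrite mulrDl opprD addrACA.
by rewrite (le_trans (ler_normD _ _))// lerD ?fK ?gM.
Qed.

(** The iterates contribute [K], [K / 2], [K / 4] and so on, so the constant does not depend on
    [n]. *)
Lemma weight_lip_transfer_sum f K n : weight_lip K f ->
  weight_lip (2 * K) (transfer_sum f n).
Proof.
move=> fK; have K0 := weight_lip_ge0 fK.
elim: n => [|n IH] /=.
  move=> s t s0 st t1; rewrite subrr normr0 !mulr_ge0//.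
  by rewrite subr_ge0; exact: weight_le.
rewrite (_ : 2 * K = K + (2 * K) / 2); last by field.
by apply: weight_lipD => //; exact: weight_lip_transfer.
Qed.

Lemma transfer_sum_ge0 f K n s : weight_lip K f ->
  (forall t, 0 <= t <= 1 -> 0 <= f t) -> 0 <= s <= 1 -> 0 <= transfer_sum f n s.
Proof.
move=> fK f0; elim: n s => [//|n IH] s s01 /=.
rewrite addr_ge0 ?f0//; have /andP[s0 _] := s01.
apply: digit_exp_ge0 => //.
  exact: digit_bounded_weight_lip (weight_lip_transfer_sum n fK) s0.
by move=> a a0; apply: IH; exact: inv_digit_itv.
Qed.

(** Averaging does not increase a uniform error, so [e] is paid once per iterate. *)
Lemma transfer_sum_dist f g K M c e n s : weight_lip K f -> weight_lip M g ->
  (forall t, 0 <= t <= 1 -> `|f t - c * g t| <= e) -> 0 <= s <= 1 ->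
  `|transfer_sum f n s - c * transfer_sum g n s| <= n%:R * e.
Proof.
move=> fK gM fg; elim: n s => [|n IH] s s01 /=.
  by rewrite mulr0 subrr normr0 mul0r.
have /andP[s0 s1] := s01.
have bf := digit_bounded_weight_lip (weight_lip_transfer_sum n fK) s0.
have bg := digit_bounded_weight_lip (weight_lip_transfer_sum n gM) s0.
have bcg := digit_boundedZ c bg.
have -> : f s + transfer (transfer_sum f n) s -
    c * (g s + transfer (transfer_sum g n) s) = (f s - c * g s) +
    digit_exp s (fun a => transfer_sum f n (a%:R + s)^-1 -
       c * transfer_sum g n (a%:R + s)^-1).
  by rewrite digit_expB// digit_expZ// /transfer; ring.
rewrite (le_trans (ler_normD _ _))// -natr1 mulrDl mul1r addrC lerD ?fg//.
rewrite ler_norml; apply: digit_exp_itv => // a a0.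
by rewrite -ler_norml; apply: IH; exact: inv_digit_itv.
Qed.

(** [weight_lip] controls a function on [[0, 1]] only; composing with [clamp] makes it continuous on
    the whole line, as [gauss_integral_transfer] requires. *)
Definition clamp x : R := Num.max 0 (Num.min x 1).

Lemma clamp_itv x : 0 <= clamp x <= 1.
Proof. by rewrite /clamp le_max lexx/= ge_max ler01/= ge_min lexx orbT. Qed.

Lemma clamp_id x : 0 <= x <= 1 -> clamp x = x.
Proof. by move=> /andP[x0 x1]; rewrite /clamp min_l// max_r. Qed.

Lemma clamp_lip x y : x <= y -> 0 <= clamp y - clamp x <= y - x.
Proof.
move=> xy; rewrite /clamp /Num.min.
by case: (ltP x 1) => ?; case: (ltP y 1) => ?; rewrite /Num.max; do !case: ltP => ?;
  apply/andP; split; lra.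
Qed.

Lemma weightB_le s t : 0 <= s -> s <= t -> weight t - weight s <= t - s.
Proof.
move=> s0 st; rewrite weightB//; last lra.
have d1 : 1 <= (1 + 2 * s) * (1 + 2 * t) by nra.
by rewrite ler_pdivrMr ?(lt_le_trans ltr01)// ler_peMr// subr_ge0.
Qed.

Lemma continuous_clamp h K : weight_lip K h -> continuous (h \o clamp).
Proof.
move=> hK; have K0 := weight_lip_ge0 hK.
have L x y : x <= y -> `|h (clamp y) - h (clamp x)| <= K * (y - x).
  move=> xy; have /andP[c0 c1] := clamp_lip xy.
  have /andP[x0 x1] := clamp_itv x; have /andP[y0 y1] := clamp_itv y.
  have xy' : clamp x <= clamp y by lra.
  apply: le_trans (hK _ _ x0 xy' y1) _; rewrite ler_wpM2l//.
  exact: le_trans (weightB_le x0 xy') c1.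
have L' x y : `|h (clamp x) - h (clamp y)| <= K * `|x - y|.
  have [xy|/ltW yx] := leP x y.
    by rewrite distrC (distrC x) [`|y - x|]ger0_norm ?subr_ge0// L.
  by rewrite [`|x - y|]ger0_norm ?subr_ge0// L.
move=> x; apply/cvgrPdist_le => e e0; have K1 : 0 < K + 1 by lra.
near=> y.
rewrite /=; apply: le_trans (L' x y) _.
have : `|x - y| <= e / (K + 1).
  near: y; have /cvgrPdist_le : y @[y --> x] --> x by exact: cvg_id.
  by apply; rewrite divr_gt0.
rewrite ler_pdivlMr// => h1.
by have := normr_ge0 (x - y); nra.
Unshelve. all: end_near. Qed.

Lemma eq_gauss_integral h g : (forall x, 0 <= x <= 1 -> h x = g x) ->
  gauss_integral h = gauss_integral g.
Proof.
by move=> hg; apply: eq_integral => x; rewrite inE/= in_itv/= => /hg ->.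
Qed.

Lemma measurable_gauss_integrand h K : weight_lip K h ->
  measurable_fun (`[0, 1]%classic : set R) (fun x : R => (h x / (1 + x))%:E).
Proof.
move=> hK; apply: (eq_measurable_fun (fun x => ((h \o clamp) x / (1 + x))%:E)).
  by move=> x; rewrite inE/= in_itv/= => x01; rewrite clamp_id.
apply: within_continuous_measurable => x; rewrite in_itv/= => /andP[x0 _].
by apply: continuous_gauss_integrand => //; exact: continuous_clamp hK.
Qed.

Lemma gauss_integral_transfer_lip h K : weight_lip K h ->
  (forall x, 0 <= x <= 1 -> 0 <= h x) ->
  gauss_integral (transfer h) = gauss_integral h.
Proof.
move=> hK h0; transitivity (gauss_integral (transfer (h \o clamp))).
  apply: eq_gauss_integral => x /andP[x0 _]; apply: eq_digit_exp => a a0 /=.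
  by rewrite clamp_id//; exact: inv_digit_itv.
rewrite (@gauss_integral_transfer _ (h \o clamp) (h 0 + K)).
- by apply: eq_gauss_integral => x x01 /=; rewrite clamp_id.
- exact: continuous_clamp hK.
- move=> x _ /=; rewrite h0 ?clamp_itv//=.
  by have /andP[] := weight_lip_bounded hK (clamp_itv x).
Qed.

Lemma gauss_integralD h g K M : weight_lip K h -> weight_lip M g ->
  (forall x, 0 <= x <= 1 -> 0 <= h x) -> (forall x, 0 <= x <= 1 -> 0 <= g x) ->
  (gauss_integral (fun x => h x + g x)%R = gauss_integral h + gauss_integral g)%E.
Proof.
move=> hK gM h0 g0; rewrite /gauss_integral.
rewrite -ge0_integralD//=.
- by apply: eq_integral => x _; rewrite -EFinD mulrDl.
- move=> x; rewrite in_itv/= => x01; have /andP[x0 _] := x01.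
  by rewrite lee_fin divr_ge0 ?h0//; lra.
- exact: measurable_gauss_integrand hK.
- move=> x; rewrite in_itv/= => x01; have /andP[x0 _] := x01.
  by rewrite lee_fin divr_ge0 ?g0//; lra.
- exact: measurable_gauss_integrand gM.
Qed.

Lemma gauss_integral_le h g K M : weight_lip K h -> weight_lip M g ->
  (forall x, 0 <= x <= 1 -> 0 <= h x) -> (forall x, 0 <= x <= 1 -> h x <= g x) ->
  (gauss_integral h <= gauss_integral g)%E.
Proof.
move=> hK gM h0 hg; apply: ge0_le_integral => //=.
- move=> x; rewrite in_itv/= => x01; have /andP[x0 _] := x01.
  by rewrite lee_fin divr_ge0 ?h0//; lra.
- exact: measurable_gauss_integrand hK.
- exact: measurable_gauss_integrand gM.
- move=> x; rewrite in_itv/= => x01; have /andP[x0 _] := x01.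
  by rewrite lee_fin ler_wpM2r ?hg// invr_ge0; lra.
Qed.

Lemma gauss_integral_cst c : gauss_integral (fun=> c) = (c * ln 2)%:E.
Proof.
have dl x : 0 <= x -> is_derive x 1 (fun y : R => c * ln (1 + y)) (c / (1 + x)).
  move=> x0; have x1 : 0 < 1 + x by lra.
  have d : is_derive x 1 (fun y : R => 1 + y) 1.
    by rewrite -[X in is_derive _ _ _ X]add0r; apply: is_deriveD.
  have dln := is_derive1_ln x1.
  have := @is_derive1_comp _ (@ln R) (fun y : R => 1 + y) x _ _ dln d.
  rewrite mulr1 => dc.
  by have := @is_deriveZ _ _ _ _ c x 1 _ dc.
have c1 x : 0 <= x -> {for x, continuous (fun y : R => c / (1 + y))}.
  by move=> x0; apply: (@continuous_gauss_integrand R (fun=> c)) => // ?; exact: cvg_cst.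
have cl x : 0 <= x -> {for x, continuous (fun y : R => c * ln (1 + y))}.
  move=> x0; apply: differentiable_continuous.
  by apply/derivable1_diffP; have [] := dl x x0.
rewrite /gauss_integral (@continuous_FTC2 _ _ (fun y : R => c * ln (1 + y)))//.
- by rewrite addr0 ln1 mulr0 sube0.
- apply: continuous_in_subspaceT => x; rewrite inE/= in_itv/= => /andP[x0 _].
  exact: c1.
- split.
  + by move=> x; rewrite in_itv/= => /andP[x0 _]; have [] := dl x (ltW x0).
  + by apply: cvg_at_right_filter; exact: cl.
  + by apply: cvg_at_left_filter; exact: cl.
- move=> x; rewrite in_itv/= => /andP[x0 _].
  by rewrite derive1E; have [_ ->] := dl x (ltW x0).
Qed.

Lemma weight_lip_cst c : weight_lip 0 (fun=> c).
Proof. by move=> s t _ _ _; rewrite subrr normr0 mul0r. Qed.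

(** On [[0, 1]] the product [(1 + 2 s) (1 + 2 t)] is at most 9. *)
Lemma le_weightB s t : 0 <= s -> s <= t -> t <= 1 ->
  t - s <= 9 * (weight t - weight s).
Proof.
move=> s0 st t1; rewrite weightB//; last lra.
have d1 : 1 <= (1 + 2 * s) * (1 + 2 * t) by nra.
have d2 : (1 + 2 * s) * (1 + 2 * t) <= 9 by nra.
rewrite mulrA ler_pdivlMr ?(lt_le_trans ltr01)// mulrC ler_wpM2r//.
by rewrite subr_ge0.
Qed.

Lemma weight_lip_add1 : weight_lip 9 (fun s : R => 1 + s).
Proof.
move=> s t s0 st t1; rewrite opprD addrACA subrr add0r.
by rewrite ger0_norm ?le_weightB// subr_ge0.
Qed.

(* The Gauss measure has mean [1 / ln 2] for [1 + s] and is preserved by [transfer];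
   contraction of the oscillation does the rest. *)
Lemma transfer_sum_add1 n s : 0 <= s <= 1 ->
  `|transfer_sum (fun s : R => 1 + s) n s - n%:R / ln 2| <= 36.
Proof.
move=> s01; pose g m : R -> R := transfer_sum (fun s : R => 1 + s) m.
have gl m : weight_lip (2 * 9) (g m) by exact: weight_lip_transfer_sum weight_lip_add1.
have g0 m x : 0 <= x <= 1 -> 0 <= g m x.
  move=> x01; apply: transfer_sum_ge0 weight_lip_add1 _ x01 => t /andP[t0 _]; lra.
have ln2 : 0 < ln (2 : R) by rewrite ln_gt0// ltr1n.
have gI m : gauss_integral (g m) = (m%:R)%:E.
  elim: m => [|m IH]; first by rewrite gauss_integral_cst mul0r.
  rewrite /g/= (@gauss_integralD _ _ 9 (2 * 9 / 2)) -/(g m).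
  - rewrite (gauss_integral_transfer_lip (gl m) (@g0 m)) IH -natr1 addrC EFinD.
    congr (_ + _)%E; rewrite (_ : gauss_integral _ = \int[mu]_(x in `[0%R, 1%R]) 1%E)%E.
      by rewrite integral_cst//= lebesgue_measure_itv/= lte01 mul1e oppr0 adde0.
    apply: eq_integral => x; rewrite inE/= in_itv/= => /andP[x0 _].
    by rewrite divff// gt_eqF//; lra.
  - exact: weight_lip_add1.
  - exact: weight_lip_transfer (gl m).
  - by move=> x /andP[x0 _]; lra.
  - move=> x x01; have /andP[x0 _] := x01; apply: digit_exp_ge0 => //.
      exact: digit_bounded_weight_lip (gl m) x0.
    by move=> a a0; apply: g0; exact: inv_digit_itv.
(* Both [g n s] and the Gauss mean of [g n] lie within 18 of [g n 0], hence 36. *)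
have hosc x : 0 <= x <= 1 -> g n 0 - 2 * 9 <= g n x <= g n 0 + 2 * 9.
  by move=> x01; exact: weight_lip_bounded (gl n) x01.
have ub : n%:R <= (g n 0 + 18) * ln 2.
  rewrite -lee_fin -gI -gauss_integral_cst.
  apply: gauss_integral_le (gl n) (weight_lip_cst _) _ _ => x x01; first exact: g0.
  by have /andP[] := hosc x x01; lra.
have lo : (g n 0 - 18) * ln 2 <= n%:R.
  (* [gauss_integral_le] needs the smaller function to be nonnegative; a negative constant makes the
     bound trivial. *)
  have [h0|h0] := leP 0 (g n 0 - 18).
    rewrite -lee_fin -gI -gauss_integral_cst.
    apply: gauss_integral_le (weight_lip_cst _) (gl n) _ _ => x x01 //.
    by have /andP[] := hosc x x01; lra.
  by rewrite (@le_trans _ _ 0)// ltW// nmulr_rlt0.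
rewrite -ler_pdivrMr// in ub; rewrite -ler_pdivlMr// in lo.
have /andP[h1 h2] := hosc s s01; rewrite -/(g n s) ler_norml; apply/andP; split; lra.
Qed.

End TransferSum.

(** * Logarithmic sums *)

Section LogSums.
Variable R : realType.
Implicit Types (x s t T : R) (a b n N : nat).

Lemma ln_succB a : (0 < a)%N ->
  (a.+1%:R)^-1 <= ln (a.+1%:R : R) - ln a%:R <= a%:R^-1.
Proof.
move=> a0; have a0' : 0 < a%:R :> R by rewrite ltr0n.
apply/andP; split.
- have -> : ln (a.+1%:R : R) - ln a%:R = - ln (1 - a.+1%:R^-1).
    rewrite -ln_div ?posrE// -lnV ?posrE; last first.
      by rewrite subr_gt0 invf_lt1// ltr1n.
    by congr ln; rewrite -natr1; field; rewrite !gt_eqF//; lra.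
  rewrite lerNr; apply: le_trans (le_ln1Dx _) _ => //.
  by rewrite ltrN2 invf_lt1// ltr1n.
- rewrite -ln_div ?posrE// (_ : _ / _ = 1 + a%:R^-1).
    by apply: le_ln1Dx; apply: lt_trans (_ : 0 < _); rewrite ?ltrN10 ?invr_gt0.
  by rewrite -natr1; field; rewrite gt_eqF.
Qed.

Lemma ln_nat_ge0 n : 0 <= ln (n%:R : R).
Proof. by case: n => [|n]; [rewrite ln0|rewrite ln_ge0// ler1n]. Qed.

Lemma sum_inv_le x : 1 <= x ->
  \sum_(1 <= a < (Num.truncn x).+1) (a%:R : R)^-1 <= 1 + ln x.
Proof.
move=> x1; have x0 : 0 <= x by lra.
have := truncn_itv x0; have := truncn_gt0 x; rewrite x1.
set N := Num.truncn x => N0 /andP[Nx _].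
suff : \sum_(1 <= a < N.+1) (a%:R : R)^-1 <= 1 + ln N%:R.
  by move=> /le_trans; apply; rewrite lerD2l ler_ln ?posrE ?ltr0n//; lra.
case: N N0 {Nx} => // N _; elim: N => [|N IH].
  by rewrite big_nat1 invr1 ln1 addr0.
rewrite big_nat_recr//=; have /andP[h _] := @ln_succB N.+1 isT.
by apply: (le_trans (lerD IH h)); lra.
Qed.

Lemma sum_invS_ge x : 1 <= x ->
  ln x - 1 <= \sum_(1 <= a < (Num.truncn x).+1) (a.+1%:R : R)^-1.
Proof.
move=> x1; have x0 : 0 <= x by lra.
have := truncn_itv x0; set N := Num.truncn x => /andP[_ Nx].
have ln2 : ln (2 : R) <= 1.
  by have := @le_ln1Dx R 1; rewrite (_ : 1 + 1 = 2) //; apply; lra.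
suff : ln N.+2%:R - ln (2 : R) <= \sum_(1 <= a < N.+1) (a.+1%:R : R)^-1.
  apply: le_trans; apply: lerB => //; rewrite ler_ln ?posrE//; last lra.
  by rewrite (le_trans (ltW Nx))// ler_nat.
elim: N {Nx} => [|N IH]; first by rewrite big_geq// subrr.
rewrite big_nat_recr//=; have /andP[_ h] := @ln_succB N.+2 isT.
by apply: le_trans (lerD IH h); lra.
Qed.

Lemma sum_inv_sqr_le N : \sum_(1 <= a < N.+1) (a%:R : R) ^- 2 <= 2.
Proof.
case: N => [|N]; first by rewrite big_geq.
suff : \sum_(1 <= a < N.+2) (a%:R : R) ^- 2 <= 2 - N.+1%:R^-1.
  by move=> /le_trans; apply; rewrite gerBl invr_ge0.
elim: N => [|N IH]; first by rewrite big_nat1 expr1n invr1; lra.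
rewrite big_nat_recr//=; apply: (le_trans (lerD IH (lexx _))).
have u1 : 1 <= N.+1%:R :> R by rewrite ler1n.
rewrite -[N.+2%:R]natr1; move: (N.+1%:R : R) u1 => u u1.
rewrite -subr_ge0 (_ : _ - _ = (u * (u + 1) ^+ 2)^-1); last first.
  by field; rewrite !gt_eqF//; lra.
by rewrite invr_ge0 mulr_ge0// ?sqr_ge0//; lra.
Qed.

(** The sum is compared with the increments of [- (ln x - ln u) ^+ 2 / 2], an antiderivative of
    [(ln x - ln u) / u]; the term [a = 1] accounts for the extra [ln x]. *)
Lemma sum_ln_div_le x : 1 <= x ->
  \sum_(1 <= a < (Num.truncn x).+1) (ln x - ln a%:R) / a%:R <=
    (ln x) ^+ 2 / 2 + ln x.
Proof.
move=> x1; have x0 : 0 <= x by lra.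
have := truncn_itv x0; have := truncn_gt0 x; rewrite x1.
set N := Num.truncn x => N0 /andP[Nx _].
suff : \sum_(1 <= a < N.+1) (ln x - ln a%:R) / a%:R <=
    ln x + (ln x ^+ 2 - (ln x - ln N%:R) ^+ 2) / 2.
  by move=> /le_trans; apply; have := sqr_ge0 (ln x - ln N%:R); lra.
case: N N0 Nx => // N _; elim: N => [|N IH] Nx.
  by rewrite big_nat1 ln1 subr0 divr1; lra.
rewrite big_nat_recr//=; have Nx' : N.+1%:R <= x.
  by apply: le_trans Nx; rewrite ler_nat.
have := lerD (IH Nx') (lexx ((ln x - ln N.+2%:R) / N.+2%:R)).
move=> /le_trans; apply.
have /andP[h _] := @ln_succB N.+1 isT.
have h' : ln N.+2%:R <= ln x by rewrite ler_ln ?posrE ?ltr0n//; lra.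
move: (N.+2%:R^-1 : R) (ln N.+2%:R) (ln N.+1%:R) h h' => u v w h h'.
have q0 : 0 <= (ln x - v) * (v - w - u) by rewrite mulr_ge0//; lra.
have q1 := sqr_ge0 (v - w).
by nra.
Qed.

Lemma sum_ln_div_ge x : 1 <= x ->
  (ln x) ^+ 2 / 2 - 1 <=
    \sum_(1 <= a < (Num.truncn x).+1) (ln x - ln a%:R) / a%:R.
Proof.
move=> x1; have x0 : 0 <= x by lra.
have := truncn_itv x0; have := truncn_gt0 x; rewrite x1.
set N := Num.truncn x => N0 /andP[Nx xN].
suff : (ln x ^+ 2 - (ln x - ln N.+1%:R) ^+ 2) / 2 <=
    \sum_(1 <= a < N.+1) (ln x - ln a%:R) / a%:R.
  apply: le_trans; have /andP[_ h] := ln_succB N0.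
  have N1 : N%:R^-1 <= 1 :> R by rewrite invf_le1 ?ltr0n// ler1n.
  have h1 : ln N%:R <= ln x by rewrite ler_ln ?posrE ?ltr0n//; lra.
  have h2 : ln x <= ln N.+1%:R by rewrite ler_ln ?posrE ?ltr0n//; lra.
  have q : 0 <= (ln N.+1%:R - ln x) * (1 - (ln N.+1%:R - ln x)).
    by rewrite mulr_ge0//; lra.
  by nra.
elim: N {N0 xN} Nx => [|N IH] Nx; first by rewrite big_geq// ln1 subr0 subrr mul0r.
rewrite big_nat_recr//=; have Nx' : N%:R <= x.
  by apply: le_trans Nx; rewrite ler_nat.
have := lerD (IH Nx') (lexx ((ln x - ln N.+1%:R) / N.+1%:R)).
apply: le_trans.
have /andP[h0 h] := @ln_succB N.+1 isT.
have h' : ln N.+1%:R <= ln x by rewrite ler_ln ?posrE ?ltr0n//; lra.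
move: (N.+1%:R^-1 : R) (ln N.+2%:R) (ln N.+1%:R) h h' h0 => u v w h h' h0.
have q0 : 0 <= (ln x - w) * (u - (v - w)) by rewrite mulr_ge0//; lra.
have q1 := sqr_ge0 (v - w).
by nra.
Qed.

End LogSums.

(** * Moments of truncated products *)

Definition trunc_digit {R : realType} (x : R) (a : nat) : R :=
  if a%:R <= x then a%:R else 0.

(** A large product is dropped, not capped: with a single exceedance, the truncated sum is then
    exactly the sum without its maximum. *)
Definition trunc_prod {R : realType} (T : R) (b a : nat) : R :=
  if (b * a)%:R <= T then (b * a)%:R else 0.

Definition prod_mean {R : realType} (T : R) (b : nat) (s : R) : R :=
  digit_exp s (trunc_prod T b).

(** The mean of the product of the next two digits. Unlike [prod_mean] it does not involve the
    previous digit, so it can be iterated under [transfer]. *)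
Definition pair_mean {R : realType} (T : R) (s : R) : R :=
  digit_exp s (fun a => prod_mean T a (a%:R + s)^-1).

Definition exceed_bound {R : realType} (T : R) (b : nat) : R :=
  Num.min 1 (2 * b%:R / T).

Section TruncatedMoments.
Variable R : realType.
Implicit Types (x s t T : R) (a b n N : nat) (G : nat -> R).

Lemma trunc_digit_itv x a : 0 <= x -> 0 <= trunc_digit x a <= x.
Proof.
by move=> x0; rewrite /trunc_digit; case: ifPn => h; rewrite ?h ?lexx ?x0 ?ler0n.
Qed.

Lemma trunc_prod_itv T b a : 0 <= T -> 0 <= trunc_prod T b a <= T.
Proof.
by move=> T0; rewrite /trunc_prod; case: ifPn => h; rewrite ?h ?lexx ?T0 ?ler0n.
Qed.

Lemma trunc_prodE T b a : (0 < b)%N ->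
  trunc_prod T b a = b%:R * trunc_digit (T / b%:R) a.
Proof.
move=> b0; rewrite /trunc_prod /trunc_digit ler_pdivlMr ?ltr0n// -natrM mulnC.
by case: ifP => _; rewrite ?mulr0// mulnC natrM.
Qed.

Lemma trunc_digit_eq0 x a : 0 <= x -> (Num.truncn x < a)%N -> trunc_digit x a = 0.
Proof. by move=> x0; rewrite truncn_lt_nat// /trunc_digit ltNge => /negbTE ->. Qed.

Lemma trunc_digit_lt1 x a : x < 1 -> trunc_digit x a = 0.
Proof.
move=> x1; rewrite /trunc_digit; case: a => [|a]; first by rewrite if_same.
rewrite ifF//; apply/negbTE; rewrite -ltNge (lt_le_trans x1)// ler1n//.
Qed.

Lemma digit_bounded_trunc_digit x : 0 <= x -> digit_bounded (trunc_digit x).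
Proof.
by move=> x0; apply: (digit_bounded_itv (m := 0) (M := x)) => a _; exact: trunc_digit_itv.
Qed.

Lemma digit_bounded_trunc_prod T b : 0 <= T -> digit_bounded (trunc_prod T b).
Proof.
by move=> x0; apply: (digit_bounded_itv (m := 0) (M := T)) => a _; exact: trunc_prod_itv.
Qed.

Lemma digit_exp_trunc_digit x s : 0 <= s <= 1 -> 1 <= x ->
  (1 + s) * (ln x - 2) <= digit_exp s (trunc_digit x) <= (1 + s) * (ln x + 1).
Proof.
move=> /andP[s0 s1] x1; have x0 : 0 <= x by lra.
rewrite (@digit_exp_finite _ _ (Num.truncn x)); last by move=> a; exact: trunc_digit_eq0.
have E a : (1 <= a < (Num.truncn x).+1)%N -> digit_prob s a * trunc_digit x a =
    (1 + s) * (a%:R / ((a%:R + s) * (a%:R + s + 1))).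
  move=> /andP[_]; rewrite ltnS truncn_ge_nat// => ax.
  by rewrite /trunc_digit ax /digit_prob mulrAC mulrA.
rewrite (eq_big_nat _ _ E) -mulr_sumr.
apply/andP; split; rewrite ler_wpM2l//; try lra.
- have h := sum_invS_ge x1.
  (* [a / ((a + 1) (a + 2))] equals [1 / (a + 1) - 2 / ((a + 1) (a + 2))]. The corrections cost 1,
     and [sum_invS_ge] costs another 1. *)
  have h2 : \sum_(1 <= a < (Num.truncn x).+1) 2 / (a.+1%:R * a.+2%:R) <= 1 :> R.
    elim: (Num.truncn x) => [|N IH]; first by rewrite big_geq.
    suff E2 n : \sum_(1 <= a < n.+1) 2 / (a.+1%:R * a.+2%:R) = 1 - 2 / n.+2%:R :> R.
      by rewrite E2 gerBl.
    elim: n {IH} => [|n IH]; first by rewrite big_geq// divff// subrr.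
    rewrite big_nat_recr//= IH -!natr1; have n0 : 0 <= n%:R :> R by [].
    by field; rewrite !gt_eqF//; lra.
  apply: le_trans (_ : \sum_(1 <= a < (Num.truncn x).+1)
      ((a.+1%:R)^-1 - 2 / (a.+1%:R * a.+2%:R)) <= _).
    by rewrite sumrB; lra.
  rewrite ler_sum_nat// => a /andP[a1 _].
  have a1' : 1 <= a%:R :> R by rewrite ler1n.
  rewrite -!natr1 (_ : _ - _ = a%:R / ((a%:R + 1) * (a%:R + 1 + 1))); last first.
    by field; rewrite !gt_eqF//; lra.
  rewrite ler_wpM2l// lef_pV2 ?posrE; [|by rewrite mulr_gt0//; lra..].
  by rewrite ler_pM//; lra.
- apply: le_trans (_ : \sum_(1 <= a < (Num.truncn x).+1) (a%:R)^-1 <= _).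
    rewrite ler_sum_nat// => a /andP[a1 _].
    have a1' : 1 <= a%:R :> R by rewrite ler1n.
    rewrite ler_pdivrMr; last by rewrite mulr_gt0//; lra.
    by rewrite ler_pdivlMl; [nra|lra].
  by rewrite addrC; exact: sum_inv_le.
Qed.

Lemma ln_div_nat T b : 1 <= T -> (0 < b)%N -> ln (T / b%:R) = ln T - ln b%:R.
Proof. by move=> T1 b0; rewrite ln_div ?posrE ?ltr0n//; lra. Qed.

Lemma prod_mean_bounds T b s : 0 <= s <= 1 -> 1 <= T -> (0 < b)%N -> b%:R <= T ->
  b%:R * ((1 + s) * (ln T - ln b%:R - 2)) <= prod_mean T b s <=
  b%:R * ((1 + s) * (ln T - ln b%:R + 1)).
Proof.
move=> s01 T1 b0 bT; have b0' : 0 < b%:R :> R by rewrite ltr0n.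
have /andP[s0 _] := s01.
have x1 : 1 <= T / b%:R by rewrite ler_pdivlMr// mul1r.
rewrite /prod_mean (@eq_digit_exp _ _ _ (fun a => b%:R * trunc_digit (T / b%:R) a)).
  rewrite digit_expZ//; last by apply: digit_bounded_trunc_digit; lra.
  rewrite !(ler_pM2l b0') -ln_div_nat//; exact: digit_exp_trunc_digit.
by move=> a _; exact: trunc_prodE.
Qed.

Lemma prod_mean_eq0 T b s : 0 <= s -> 0 <= T -> T < b%:R -> prod_mean T b s = 0.
Proof.
move=> s0 T0 Tb; have b0 : (0 < b)%N by rewrite -(ltr0n R); lra.
rewrite -[RHS](@digit_exp_cst R s 0)//; apply: eq_digit_exp => a _.
by rewrite trunc_prodE// trunc_digit_lt1 ?mulr0// ltr_pdivrMr ?ltr0n// mul1r.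
Qed.

Lemma prod_mean_ge0 T b s : 0 <= s -> 0 <= T -> 0 <= prod_mean T b s <= T.
Proof. by move=> s0 T0; apply: digit_exp_itv => // a _; exact: trunc_prod_itv. Qed.

Lemma digit_bounded_prod_mean T s : 0 <= s -> 0 <= T ->
  digit_bounded (fun a => prod_mean T a (a%:R + s)^-1).
Proof.
move=> s0 T0; apply: (digit_bounded_itv (m := 0) (M := T)) => a a0.
by apply: prod_mean_ge0 => //; have /andP[] := inv_digit_itv s0 a0.
Qed.

Lemma pair_mean_approx T s : 0 <= s <= 1 -> 1 <= T ->
  `|pair_mean T s - ln T ^+ 2 / 2 * (1 + s)| <= 12 * (1 + ln T).
Proof.
move=> s01 T1; have /andP[s0 s1] := s01; have T0 : 0 <= T by lra.
have L0 : 0 <= ln T by rewrite ln_ge0.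
rewrite /pair_mean (@digit_exp_finite _ _ (Num.truncn T)); last first.
  move=> a; rewrite truncn_lt_nat// => Ta; apply: prod_mean_eq0 => //.
  by rewrite invr_ge0 addr_ge0.
have B a : (1 <= a < (Num.truncn T).+1)%N ->
   (1 + s) * ((ln T - ln a%:R) / a%:R - 2 * ln T * a%:R ^- 2 - 2 * a%:R^-1) <=
   digit_prob s a * prod_mean T a (a%:R + s)^-1 <=
   (1 + s) * ((ln T - ln a%:R) / a%:R + a%:R^-1).
  move=> /andP[a0]; rewrite ltnS truncn_ge_nat// => aT.
  have a1 : 1 <= a%:R :> R by rewrite ler1n.
  have /andP[lo up] := prod_mean_bounds (inv_digit_itv s0 a0) T1 a0 aT.
  have P0 := digit_prob_ge0 s0 a0.
  have la : ln a%:R <= ln T by rewrite ler_ln ?posrE; lra.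
  have la0 := @ln_nat_ge0 R a.
  (* The factor [1 + 1 / (a + s)], from the state after [a], cancels [a + s + 1] in [digit_prob];
     what remains is [(1 + s) a / (a + s) ^+ 2], close to [(1 + s) / a]. *)
  have E y : digit_prob s a * (a%:R * ((1 + (a%:R + s)^-1) * y)) =
      (1 + s) * (a%:R / (a%:R + s) ^+ 2 * y).
    by rewrite /digit_prob; field; rewrite !gt_eqF//; lra.
  have q1 : a%:R / (a%:R + s) ^+ 2 <= a%:R^-1.
    rewrite ler_pdivrMr; last by rewrite exprn_gt0//; lra.
    by rewrite ler_pdivlMl; [nra|lra].
  have q2 : a%:R^-1 - 2 * a%:R ^- 2 <= a%:R / (a%:R + s) ^+ 2.
    apply: le_trans (_ : a%:R / (a%:R + 1) ^+ 2 <= _).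
      rewrite -subr_ge0 (_ : _ - _ =
          (3 * a%:R + 2) / (a%:R ^+ 2 * (a%:R + 1) ^+ 2)); last first.
        by field; rewrite !gt_eqF//; lra.
      by rewrite divr_ge0 ?mulr_ge0 ?sqr_ge0//; lra.
    rewrite ler_wpM2l// lef_pV2 ?posrE; [|by rewrite exprn_gt0//; lra..].
    by rewrite ler_pXn2r ?nnegrE//; lra.
  have q0 : 0 <= a%:R ^- 2 :> R by rewrite invr_ge0 sqr_ge0.
  have q3 : 0 < a%:R^-1 :> R by rewrite invr_gt0; lra.
  apply/andP; split.
    apply: le_trans (ler_wpM2l P0 lo); rewrite E ler_wpM2l//; first lra.
    move: (a%:R / (a%:R + s) ^+ 2) (a%:R^-1) (a%:R ^- 2) q0 q1 q2 q3 => q u v q0 q1 q2 q3.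
    have m1 : 0 <= (ln T - ln a%:R) * (q - (u - 2 * v)) by rewrite mulr_ge0//; lra.
    have m2 : 0 <= ln a%:R * v by rewrite mulr_ge0//; lra.
    by nra.
  apply: le_trans (ler_wpM2l P0 up) _; rewrite E ler_wpM2l//; first lra.
  by rewrite -[X in _ <= _ + X]mul1r -mulrDl mulrC ler_wpM2l//; lra.
set N := Num.truncn T in B *; set S := \sum_(_ <= _ < _) _.
have lo : (1 + s) * (\sum_(1 <= a < N.+1) (ln T - ln a%:R) / a%:R
    - 2 * ln T * \sum_(1 <= a < N.+1) a%:R ^- 2
    - 2 * \sum_(1 <= a < N.+1) a%:R^-1) <= S.
  rewrite !mulr_sumr -!sumrB mulr_sumr ler_sum_nat// => a aN.
  by have /andP[] := B a aN.
have up : S <= (1 + s) * (\sum_(1 <= a < N.+1) (ln T - ln a%:R) / a%:R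
    + \sum_(1 <= a < N.+1) a%:R^-1).
  rewrite -big_split/= mulr_sumr ler_sum_nat// => a aN.
  by have /andP[] := B a aN.
have h1 := sum_ln_div_le T1; have h2 := sum_ln_div_ge T1.
have h3 := sum_inv_le T1; have h4 := @sum_inv_sqr_le R N.
rewrite -/N in h1 h2 h3.
move: lo up h1 h2 h3 h4; set A := \sum_(_ <= _ < _) _; set C := \sum_(_ <= _ < _) _.
set D := \sum_(_ <= _ < _) _ => lo up h1 h2 h3 h4.
have s1' : 0 <= 1 + s by lra.
(* The error [6 ln T + 3] is at most doubled by [1 + s], hence the constant 12. *)
have lo' : (1 + s) * (ln T ^+ 2 / 2 - 1 - 2 * ln T * 2 - 2 * (1 + ln T)) <= S.
  apply: le_trans lo; rewrite ler_wpM2l//.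
  have : 0 <= ln T * (2 - C) by rewrite mulr_ge0//; lra.
  by lra.
have up' : S <= (1 + s) * (ln T ^+ 2 / 2 + ln T + (1 + ln T)).
  by apply: le_trans up _; rewrite ler_wpM2l//; lra.
by rewrite ler_norml; apply/andP; split; nra.
Qed.

Lemma pair_mean_ge0 T s : 0 <= s -> 0 <= T -> 0 <= pair_mean T s.
Proof.
move=> s0 T0; apply: digit_exp_ge0 => //; first exact: digit_bounded_prod_mean.
move=> a a0; have /andP[u0 _] := inv_digit_itv s0 a0.
by have /andP[] := prod_mean_ge0 a u0 T0.
Qed.

Lemma pair_mean_le T s : 0 <= s <= 1 -> 1 <= T ->
  pair_mean T s <= 13 * (1 + ln T) ^+ 2.
Proof.
move=> s01 T1; have := pair_mean_approx s01 T1; have /andP[s0 s1] := s01.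
have L0 : 0 <= ln T by rewrite ln_ge0.
by rewrite ler_norml => /andP[_ h]; nra.
Qed.

(* Each of the three factors of [digit_prob] changes by a ratio of at most
   [1 + |s - t|]. *)
Lemma digit_prob_lip s t a : 0 <= s <= 1 -> 0 <= t <= 1 -> (0 < a)%N ->
  digit_prob s a <= (1 + 7 * `|s - t|) * digit_prob t a.
Proof.
move=> /andP[s0 s1] /andP[t0 t1] a0; have a1 : 1 <= a%:R :> R by rewrite ler1n.
set d := `|s - t|.
have /andP[d1 d2] : t - s <= d <= 1.
  by rewrite /d ler_norml; have := ler_norm (t - s); rewrite distrC => ->; lra.
have d3 : s - t <= d by exact: ler_norm.
have d0 : 0 <= d by exact: normr_ge0.
have h1 : 1 + s <= (1 + d) * (1 + t) by nra.
have inv u : 1 <= u -> u <= 3 + a%:R -> (u + s)^-1 <= (1 + d) * (u + t)^-1.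
  move=> u1 _; rewrite -[X in _ <= X]invrK invfM invrK lef_pV2 ?posrE; last 2 first.
  - lra.
  - by rewrite mulr_gt0 ?invr_gt0//; lra.
  by rewrite mulrC ler_pdivrMr; nra.
have h2 : (a%:R + s)^-1 <= (1 + d) * (a%:R + t)^-1 by apply: inv; lra.
have h3 : (a%:R + s + 1)^-1 <= (1 + d) * (a%:R + t + 1)^-1.
  by rewrite !(addrAC _ _ 1); apply: inv; lra.
have P2 : 0 <= (a%:R + s)^-1 by rewrite invr_ge0; lra.
have P3 : 0 <= (a%:R + s + 1)^-1 by rewrite invr_ge0; lra.
have h23 := ler_pM P2 P3 h2 h3.
have P1 : 0 <= 1 + s by lra.
have h123 := ler_pM P1 (mulr_ge0 P2 P3) h1 h23.
rewrite /digit_prob !invfM; apply: le_trans h123 _.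
have -> : (1 + d) * (1 + t) * ((1 + d) * (a%:R + t)^-1 *
    ((1 + d) * (a%:R + t + 1)^-1)) =
  (1 + d) ^+ 3 * ((1 + t) * ((a%:R + t)^-1 * (a%:R + t + 1)^-1)).
  move: (_^-1) (_^-1) => u v; ring.
rewrite ler_wpM2r//; first by rewrite !mulr_ge0 ?invr_ge0//; lra.
(* [(1 + d) ^+ 3 <= 1 + 7 d] for [0 <= d <= 1]. *)
by nra.
Qed.

Lemma digit_exp_lip s t G : 0 <= s <= 1 -> 0 <= t <= 1 -> digit_bounded G ->
  (forall a, (0 < a)%N -> 0 <= G a) ->
  digit_exp s G <= (1 + 7 * `|s - t|) * digit_exp t G.
Proof.
move=> s01 t01 bG G0; have /andP[s0 _] := s01; have /andP[t0 _] := t01.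
have cs := digit_exp_cvg s0 bG; have ct := digit_exp_cvg t0 bG.
rewrite /digit_exp -[X in _ <= X](lim_seriesZ _ ct); apply: lim_series_le => //.
  exact: is_cvg_seriesZ.
move=> k /=; rewrite -[X in _ <= X]/(_ * (_ * _)) mulrA ler_wpM2r ?G0//.
exact: digit_prob_lip.
Qed.

Lemma inv_digit_dist s t a : 0 <= s -> 0 <= t -> (0 < a)%N ->
  `|(a%:R + s)^-1 - (a%:R + t)^-1| <= `|s - t|.
Proof.
move=> s0 t0 a0; have a1 : 1 <= a%:R :> R by rewrite ler1n.
rewrite (_ : _ - _ = (t - s) / ((a%:R + s) * (a%:R + t))); last first.
  by field; rewrite !gt_eqF//; lra.
rewrite normrM normfV distrC [X in _ / X]ger0_norm; last by rewrite mulr_ge0//; lra.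
rewrite ler_pdivrMr; last by rewrite mulr_gt0//; lra.
by rewrite ler_peMr//; nra.
Qed.

(* [819 = 63 * 13], as [(1 + 7 d) ^+ 2 <= 1 + 63 * d] and by [pair_mean_le]. *)
Lemma pair_mean_lip s t T : 0 <= s <= 1 -> 0 <= t <= 1 -> 1 <= T ->
  pair_mean T s - pair_mean T t <= 819 * (1 + ln T) ^+ 2 * `|s - t|.
Proof.
move=> s01 t01 T1; have /andP[s0 s1] := s01; have /andP[t0 t1] := t01.
have T0 : 0 <= T by lra.
set d := `|s - t|; have d0 : 0 <= d by exact: normr_ge0.
have d1 : d <= 1 by rewrite /d ler_norml; apply/andP; split; lra.
have bs := digit_bounded_prod_mean s0 T0.
have bt := digit_bounded_prod_mean t0 T0.
have h1 : pair_mean T s <= (1 + 7 * d) * digit_exp s (fun a => prod_mean T a (a%:R + t)^-1).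
  rewrite /pair_mean -digit_expZ//; apply: digit_exp_le => //.
    exact: digit_boundedZ.
  move=> a a0; have us := inv_digit_itv s0 a0; have ut := inv_digit_itv t0 a0.
  apply: le_trans (digit_exp_lip us ut _ _) _.
  - exact: digit_bounded_trunc_prod.
  - by move=> b _; have /andP[] := trunc_prod_itv a b T0.
  - have /andP[ut0 _] := ut; rewrite ler_wpM2r//.
      by have /andP[] := prod_mean_ge0 a ut0 T0.
    by rewrite lerD2l ler_wpM2l// inv_digit_dist.
have h2 : digit_exp s (fun a => prod_mean T a (a%:R + t)^-1) <=
    (1 + 7 * d) * pair_mean T t.
  apply: digit_exp_lip => // a a0; have /andP[ut0 _] := inv_digit_itv t0 a0.
  by have /andP[] := prod_mean_ge0 a ut0 T0.
have f0 := pair_mean_ge0 t0 T0; have f1 := pair_mean_le t01 T1.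
have h3 : pair_mean T s <= (1 + 63 * d) * pair_mean T t.
  apply: (le_trans h1); apply: (le_trans (ler_wpM2l _ h2)); first lra.
  by rewrite mulrA ler_wpM2r//; nra.
have : 63 * d * pair_mean T t <= 63 * d * (13 * (1 + ln T) ^+ 2).
  by rewrite ler_wpM2l//; lra.
by lra.
Qed.

(** [7371 = 9 * 819], the 9 coming from [le_weightB]. *)
Lemma weight_lip_pair_mean T : 1 <= T ->
  weight_lip (7371 * (1 + ln T) ^+ 2) (pair_mean T).
Proof.
move=> T1 s t s0 st t1.
have s01 : 0 <= s <= 1 by apply/andP; split; lra.
have t01 : 0 <= t <= 1 by apply/andP; split; lra.
have L0 := sqr_ge0 (1 + ln T).
have h1 := pair_mean_lip s01 t01 T1; have h2 := pair_mean_lip t01 s01 T1.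
have d : `|t - s| = t - s by rewrite ger0_norm// subr_ge0.
rewrite distrC d in h1; rewrite d in h2.
have := ler_wpM2l L0 (le_weightB s0 st t1).
by move=> h3; rewrite ler_norml; apply/andP; split; lra.
Qed.

(** [digit_prob s a * a ^+ 2 <= 2] and at most [T / b] digits count, giving [b ^+ 2 * 2 * T / b].
    The truncation of [b] on the right keeps the mean over [b] logarithmic in [T]. *)
Lemma digit_exp_trunc_prod_sqr T b s : 0 <= s <= 1 -> 1 <= T ->
  digit_exp s (fun a => trunc_prod T b a ^+ 2) <= 2 * T * trunc_digit T b.
Proof.
move=> s01 T1; have /andP[s0 s1] := s01; have T0 : 0 <= T by lra.
case: b => [|b'].
  rewrite (@eq_digit_exp _ _ _ (fun=> 0)) ?digit_exp_cst ?mulr_ge0//; last 2 first.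
  - by have /andP[] := trunc_digit_itv 0 T0.
  - by move=> a _; rewrite /trunc_prod mul0n if_same expr0n.
set b := b'.+1; have b0 : 0 < b%:R :> R by rewrite ltr0n.
have x0 : 0 <= T / b%:R by rewrite divr_ge0// ltW.
rewrite (@eq_digit_exp _ _ _ (fun a => b%:R ^+ 2 * trunc_digit (T / b%:R) a ^+ 2)); last first.
  by move=> a _; rewrite trunc_prodE// exprMn.
rewrite digit_expZ//; last exact/digit_bounded_sqr/digit_bounded_trunc_digit.
rewrite (@digit_exp_finite _ _ (Num.truncn (T / b%:R))); last first.
  by move=> a ha; rewrite trunc_digit_eq0// expr0n.
have [bT|Tb] := leP b%:R T; last first.
  rewrite big1 ?mulr0 ?mulr_ge0//; last first.
    by move=> a _; rewrite trunc_digit_lt1 ?expr0n ?mulr0// ltr_pdivrMr ?mul1r.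
  by have /andP[] := trunc_digit_itv b T0.
rewrite /(trunc_digit T b) bT.
apply: (@le_trans _ _ (b%:R ^+ 2 * \sum_(1 <= a < (Num.truncn (T / b%:R)).+1) 2)).
  rewrite ler_wpM2l ?sqr_ge0// ler_sum_nat// => a /andP[a0].
  rewrite ltnS truncn_ge_nat// => ab; rewrite /trunc_digit ab.
  have a1 : 1 <= a%:R :> R by rewrite ler1n.
  rewrite /digit_prob mulrAC ler_pdivrMr; last by rewrite mulr_gt0//; lra.
  have : a%:R ^+ 2 <= (a%:R + s) * (a%:R + s + 1) by nra.
  have := sqr_ge0 (a%:R : R).
  by nra.
rewrite sumr_const_nat subn1/= -[2 *+ _]mulr_natr.
have : (Num.truncn (T / b%:R))%:R <= T / b%:R by rewrite truncn_le.
rewrite ler_pdivlMr// => h.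
by nra.
Qed.

Lemma digit_exp_trunc_digit_le T s : 0 <= s <= 1 -> 1 <= T ->
  digit_exp s (trunc_digit T) <= 2 * (1 + ln T).
Proof.
move=> s01 T1; have /andP[_ h] := digit_exp_trunc_digit s01 T1.
have /andP[s0 s1] := s01; have L0 : 0 <= ln T by rewrite ln_ge0.
by nra.
Qed.

Lemma digit_exp_prod_mean_sqr T s : 0 <= s <= 1 -> 1 <= T ->
  digit_exp s (fun a => prod_mean T a (a%:R + s)^-1 ^+ 2) <= 4 * T * (1 + ln T).
Proof.
move=> s01 T1; have /andP[s0 s1] := s01; have T0 : 0 <= T by lra.
have bd := digit_bounded_trunc_digit T0.
apply: le_trans (_ : digit_exp s (fun a => 2 * T * trunc_digit T a) <= _).
  apply: digit_exp_le => //.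
  - exact/digit_bounded_sqr/digit_bounded_prod_mean.
  - exact: digit_boundedZ.
  - move=> a a0; have u01 := inv_digit_itv s0 a0; have /andP[u0 _] := u01.
    apply: le_trans (digit_exp_trunc_prod_sqr a u01 T1).
    by apply: digit_exp_sqr => //; exact: digit_bounded_trunc_prod.
rewrite digit_expZ//.
have h : 0 <= 2 * T by lra.
by have := ler_wpM2l h (digit_exp_trunc_digit_le s01 T1); lra.
Qed.

Lemma exceed_bound_itv T b : 0 < T -> 0 <= exceed_bound T b <= 1.
Proof.
move=> T0; rewrite /exceed_bound le_min ler01/= ge_min lexx/= andbT.
by rewrite divr_ge0 ?mulr_ge0// ltW.
Qed.

Lemma digit_exp_exceed T b s : 0 <= s <= 1 -> 0 < T ->
  digit_exp s (fun a => (T < (b * a)%:R)%R%:R) <= exceed_bound T b.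
Proof.
move=> s01 T0; have /andP[s0 s1] := s01; rewrite /exceed_bound le_min; apply/andP; split.
  have H a : (0 < a)%N -> 0 <= ((T < (b * a)%:R)%R%:R : R) <= 1.
    by move=> _; case: (_ < _); rewrite lexx ler01.
  by have /andP[] := digit_exp_itv s0 H.
case: b => [|b].
  rewrite (@eq_digit_exp _ _ _ (fun=> 0)) ?digit_exp_cst ?mulr0 ?mul0r//.
  by move=> a _; rewrite mul0n ltNge ltW.
rewrite (@eq_digit_exp _ _ _ (fun a => (T / b.+1%:R < a%:R)%R%:R)); last first.
  by move=> a _; rewrite ltr_pdivrMr ?ltr0n// -natrM mulnC.
by rewrite -mulrA -[X in 2 * X]invf_div; apply: digit_tail_le => //; rewrite divr_gt0// ltr0n.
Qed.

(** The digits [a > T] contribute at most [2 / T], the others [2 / T] times the truncated mean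
    [2 (1 + ln T)]. *)
Lemma digit_exp_exceed_bound T s : 0 <= s <= 1 -> 1 <= T ->
  digit_exp s (exceed_bound T) <= 6 * (1 + ln T) / T.
Proof.
move=> s01 T1; have /andP[s0 s1] := s01; have T0 : 0 < T by lra.
have bd := digit_bounded_trunc_digit (ltW T0).
have b1 : digit_bounded (fun a => (T < a%:R)%R%:R : R).
  by apply: (digit_bounded_itv (m := 0) (M := 1)) => a _; case: (_ < _); rewrite lexx ler01.
have b2 : digit_bounded (fun a => 2 / T * trunc_digit T a) by exact: digit_boundedZ.
apply: le_trans (_ : digit_exp s (fun a => (T < a%:R)%R%:R + 2 / T * trunc_digit T a) <= _).
  apply: digit_exp_le => //.
  - by apply: (digit_bounded_itv (m := 0) (M := 1)) => a _; exact: exceed_bound_itv.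
  - exact: digit_boundedD.
  - move=> a _; rewrite /exceed_bound /trunc_digit [a%:R <= T]leNgt.
    case: (ltP T a%:R) => h /=; first by rewrite mulr0 addr0 ge_min lexx.
    by rewrite add0r ge_min (mulrAC 2 T^-1) lexx orbT.
rewrite digit_expD// digit_expZ//.
have h1 := digit_tail_le s01 T0.
have h2 : 2 / T * digit_exp s (trunc_digit T) <= 2 / T * (2 * (1 + ln T)).
  by rewrite ler_wpM2l ?digit_exp_trunc_digit_le// divr_ge0// ltW.
apply: le_trans (lerD h1 h2) _.
have L0 : 0 <= ln T by rewrite ln_ge0.
have TV : 0 <= T^-1 by rewrite invr_ge0 ltW.
by nra.
Qed.

End TruncatedMoments.

(** * Second moment and exceedances along words *)

(** The digit [b] precedes the word. Starting with [b = 0] kills the first product, so [n + 1]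
    digits carry the [n] products of [cf_S x n]. *)
Fixpoint trunc_sum {R : realType} (T : R) (b : nat) (w : seq nat) : R :=
  if w is a :: w' then trunc_prod T b a + trunc_sum T a w' else 0.

Fixpoint exceed_count {R : realType} (T : R) (b : nat) (w : seq nat) : nat :=
  if w is a :: w' then ((T < (b * a)%:R)%R + exceed_count T a w')%N else 0.

Fixpoint prod_sum (b : nat) (w : seq nat) : nat :=
  if w is a :: w' then (b * a + prod_sum a w')%N else 0.

Fixpoint prod_max (b : nat) (w : seq nat) : nat :=
  if w is a :: w' then maxn (b * a) (prod_max a w') else 0.

(* The expectation of [trunc_sum T b] over [n] further digits. *)
Definition mean_sum {R : realType} (T : R) (n b : nat) (s : R) : R :=
  if n is m.+1 then prod_mean T b s + transfer_sum (pair_mean T) m s else 0.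

(** The constant of [weight_lip_pair_mean], doubled by [weight_lip_transfer_sum]; it bounds
    oscillations because [weight] takes values in [[0, 1]]. *)
Definition osc_bound {R : realType} (T : R) : R := 2 * (7371 * (1 + ln T) ^+ 2).

(** [24 = 12 + 12]: one half is in [step_variance], the other is the mean of its term
    [6 * T * trunc_digit T b] over the digit [b]. *)
Definition var_bound {R : realType} (T : R) : R :=
  24 * T * (1 + ln T) + 3 * osc_bound T ^+ 2.

Definition exceed_rate {R : realType} (T : R) : R := 6 * (1 + ln T) / T.

Section WordEstimates.
Variable R : realType.
Variable T : R.
Hypothesis T1 : 1 <= T.
Implicit Types (s z l : R) (a b n : nat) (w : seq nat).

Let T0 : 0 <= T. Proof. exact: le_trans ler01 T1. Qed.
Let Tgt0 : 0 < T. Proof. exact: lt_le_trans ltr01 T1. Qed.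
Let L0 : 0 <= ln T. Proof. by rewrite ln_ge0. Qed.

Let lipS n : weight_lip (osc_bound T) (transfer_sum (pair_mean T) n).
Proof. exact/weight_lip_transfer_sum/weight_lip_pair_mean. Qed.

Lemma transfer_sum_osc n s t : 0 <= s <= 1 -> 0 <= t <= 1 ->
  `|transfer_sum (pair_mean T) n s - transfer_sum (pair_mean T) n t| <= osc_bound T.
Proof.
wlog ts : s t / t <= s.
  move=> H s01 t01; have [ts|/ltW st] := leP t s; first exact: H.
  by rewrite distrC; exact: H.
move=> /andP[s0 s1] /andP[t0 t1]; apply: le_trans (lipS n t0 ts s1) _.
have /andP[_ h1] := weight_itv s0; have /andP[h2 _] := weight_itv t0.
by rewrite ler_piMr ?(weight_lip_ge0 (lipS n))//; lra.
Qed.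

Lemma digit_bounded_mean_sum n s : 0 <= s ->
  digit_bounded (fun a => mean_sum T n a (a%:R + s)^-1).
Proof.
move=> s0; case: n => [|n] /=; first exact: digit_bounded_cst.
apply: digit_boundedD; first exact: digit_bounded_prod_mean.
exact: digit_bounded_weight_lip (lipS n) s0.
Qed.

(** The tower property, which makes [step] below centred. *)
Lemma mean_sumS n b s : 0 <= s ->
  mean_sum T n.+1 b s =
  digit_exp s (fun a => trunc_prod T b a + mean_sum T n a (a%:R + s)^-1).
Proof.
move=> s0; have bp := digit_bounded_trunc_prod b T0.
rewrite digit_expD//; last exact: digit_bounded_mean_sum.
case: n => [|n] /=; first by rewrite digit_exp_cst.
congr (_ + _); rewrite digit_expD//; first exact: digit_bounded_prod_mean.
exact: digit_bounded_weight_lip (lipS n) s0.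
Qed.

Let step n b s a : R :=
  trunc_prod T b a + mean_sum T n a (a%:R + s)^-1 - mean_sum T n.+1 b s.

Let digit_bounded_step n b s : 0 <= s -> digit_bounded (step n b s).
Proof.
move=> s0; apply: digit_boundedB; last exact: digit_bounded_cst.
apply: digit_boundedD; first exact: digit_bounded_trunc_prod.
exact: digit_bounded_mean_sum.
Qed.

Lemma digit_exp_center s (G : nat -> R) : 0 <= s -> digit_bounded G ->
  digit_exp s (fun a => (G a - digit_exp s G) ^+ 2) <=
  digit_exp s (fun a => G a ^+ 2).
Proof.
move=> s0 bG; set e := digit_exp s G.
have bG2 := digit_bounded_sqr bG; have be := digit_boundedZ (2 * e) bG.
have bc := digit_bounded_cst (e ^+ 2); have bB := digit_boundedB bG2 be.
rewrite (@eq_digit_exp _ _ _ (fun a => (G a ^+ 2 - (2 * e) * G a) + e ^+ 2)); last first.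
  by move=> a _; ring.
rewrite digit_expD// digit_expB// digit_expZ// digit_exp_cst// -/e.
by have := sqr_ge0 e; lra.
Qed.

Lemma step_variance n b s : 0 <= s <= 1 ->
  digit_exp s (fun a => step n b s a ^+ 2) <=
  6 * T * trunc_digit T b + (12 * T * (1 + ln T) + 3 * osc_bound T ^+ 2).
Proof.
move=> s01; have /andP[s0 s1] := s01.
(* Subtracting the value at the old state [s] leaves only an oscillation of [transfer_sum], bounded
   independently of [n]. *)
pose c := if n is m.+1 then transfer_sum (pair_mean T) m s else 0.
pose G a := trunc_prod T b a + mean_sum T n a (a%:R + s)^-1 - c.
have bp := digit_bounded_trunc_prod b T0; have bm := digit_bounded_mean_sum n s0.
have bs := digit_boundedD bp bm; have bc := digit_bounded_cst c.
have bG : digit_bounded G by exact: digit_boundedB.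
have E : digit_exp s G = mean_sum T n.+1 b s - c.
  by rewrite digit_expB// -mean_sumS// digit_exp_cst.
rewrite (@eq_digit_exp _ _ _ (fun a => (G a - digit_exp s G) ^+ 2)); last first.
  by move=> a _; rewrite E /step /G; congr (_ ^+ 2); ring.
apply: le_trans (digit_exp_center s0 bG) _.
have be := digit_bounded_prod_mean s0 T0.
have bp1 := digit_bounded_sqr bp; have be1 := digit_bounded_sqr be.
have bp2 := digit_boundedZ 3 bp1; have be2 := digit_boundedZ 3 be1.
have bpe := digit_boundedD bp2 be2.
have bq := digit_bounded_cst (3 * osc_bound T ^+ 2).
apply: le_trans (_ : digit_exp s (fun a => 3 * trunc_prod T b a ^+ 2 +
    3 * prod_mean T a (a%:R + s)^-1 ^+ 2 + 3 * osc_bound T ^+ 2) <= _).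
  apply: digit_exp_le => //; [exact: digit_bounded_sqr|exact: digit_boundedD|].
  move=> a a0; have u01 := inv_digit_itv s0 a0; have /andP[u0 _] := u01.
  have [v [vE Gle]] : exists v, `|v| <= osc_bound T /\
      G a ^+ 2 <= (trunc_prod T b a + prod_mean T a (a%:R + s)^-1 + v) ^+ 2.
    rewrite /G /c; case: (n) => [|m] /=.
      exists 0; rewrite normr0 !addr0 subr0; split.
        exact: weight_lip_ge0 (lipS 0).
      have /andP[h1 _] := trunc_prod_itv b a T0.
      have /andP[h2 _] := prod_mean_ge0 a u0 T0.
      by rewrite ler_pXn2r ?nnegrE//; lra.
    exists (transfer_sum (pair_mean T) m (a%:R + s)^-1 -
      transfer_sum (pair_mean T) m s); split; first exact: transfer_sum_osc.
    by rewrite !addrA.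
  apply: (le_trans Gle).
  have : v ^+ 2 <= osc_bound T ^+ 2.
    by rewrite -(real_normK (num_real v)) ler_pXn2r ?nnegrE// (le_trans _ vE).
  move: (trunc_prod _ _ _) (prod_mean _ _ _) => x y.
  have := sqr_ge0 (x - y); have := sqr_ge0 (x - v); have := sqr_ge0 (y - v).
  by nra.
rewrite digit_expD// (digit_expD s0 bp2 be2).
rewrite (digit_expZ 3 s0 bp1) (digit_expZ 3 s0 be1) digit_exp_cst//.
have := digit_exp_trunc_prod_sqr b s01 T1; have := digit_exp_prod_mean_sqr s01 T1.
by lra.
Qed.

(* The steps are martingale differences, so each adds only its own variance to the
   second moment. *)
Lemma trunc_sum_chebyshev l n b s z : 0 <= s <= 1 -> 0 < l ->
  word_prob n s (fun w => l <= `|z + trunc_sum T b w - mean_sum T n b s|) <=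
  (z ^+ 2 + 6 * T * trunc_digit T b + n%:R * var_bound T) / l ^+ 2.
Proof.
move=> s01 l0; have l2 : 0 < l ^+ 2 by rewrite exprn_gt0.
have D0 : 0 <= var_bound T.
  rewrite /var_bound; have := sqr_ge0 (osc_bound T); have := mulr_ge0 T0 L0.
  by move: (osc_bound T) => q h1 h2; have := T0; lra.
elim: n b s z s01 => [|n IH] b s z s01; have /andP[s0 s1] := s01.
  rewrite /= addr0 subr0 mul0r addr0; have /andP[d0 _] := trunc_digit_itv b T0.
  have d1 : 0 <= 6 * T * trunc_digit T b by rewrite !mulr_ge0.
  case: (leP l `|z|) => lz /=; last first.
    by rewrite divr_ge0 ?(ltW l2)// addr_ge0 ?sqr_ge0.
  rewrite ler_pdivlMr// mul1r.
  have : l ^+ 2 <= z ^+ 2.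
    by rewrite -(real_normK (num_real z)) ler_pXn2r ?nnegrE// ltW.
  by lra.
have bst := digit_bounded_step n b s0.
have bst2 := digit_bounded_sqr bst; have bz := digit_boundedZ (2 * z) bst.
have btd := digit_boundedZ (6 * T) (digit_bounded_trunc_digit T0).
have bc := digit_bounded_cst (z ^+ 2 + n%:R * var_bound T).
have b1 := digit_boundedD bst2 bz; have b2 := digit_boundedD b1 btd.
have b3 := digit_boundedD b2 bc; have b4 := digit_boundedZ (l ^- 2) b3.
apply: le_trans (word_prob_step s0 b4 _) _.
  move=> a a0; have u01 := inv_digit_itv s0 a0.
  (* The offset [z] collects the steps already made; this is why the statement has it. *)
  rewrite (_ : (fun w => _) = (fun w => l <= `|(z + step n b s a) +
      trunc_sum T a w - mean_sum T n a (a%:R + s)^-1|)); last first.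
    apply/funext => w; congr (l <= `|_|).
    by rewrite [trunc_sum T b _]/= /step; ring.
  apply: le_trans (IH a _ _ u01) _; rewrite mulrC ler_wpM2l ?invr_ge0 ?(ltW l2)//.
  by rewrite le_eqVlt; apply/orP; left; apply/eqP; ring.
rewrite digit_expZ// digit_expD// digit_expD// digit_expD// !digit_expZ//.
  rewrite digit_exp_cst// mulrC ler_wpM2r ?invr_ge0 ?(ltW l2)//.
  (* Centring removes the cross term [2 * z * step]. *)
  have E0 : digit_exp s (step n b s) = 0.
    rewrite /step digit_expB ?digit_exp_cst ?mean_sumS ?subrr//.
      by apply: digit_boundedD; [exact: digit_bounded_trunc_prod|exact: digit_bounded_mean_sum].
    exact: digit_bounded_cst.
  rewrite E0 mulr0 addr0 -[n.+1%:R]natr1.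
  have h1 := step_variance n b s01.
  have h2 := ler_wpM2l T0 (digit_exp_trunc_digit_le s01 T1).
  by rewrite /var_bound in bc b3 b4 *; lra.
exact: digit_bounded_trunc_digit.
Qed.

Let digit_bounded_01 (G : nat -> bool) : digit_bounded (fun a => (G a)%:R : R).
Proof.
apply: (digit_bounded_itv (m := 0) (M := 1)) => a _.
by case: (G a); rewrite lexx ler01.
Qed.

Let digit_bounded_eta : digit_bounded (exceed_bound T).
Proof.
by apply: (digit_bounded_itv (m := 0) (M := 1)) => a _; exact: exceed_bound_itv.
Qed.

Lemma exceed_rate_ge0 : 0 <= exceed_rate T.
Proof. by rewrite divr_ge0//; have := L0; lra. Qed.

(** A union bound. The first term keeps its dependence on [b], since in [exceed_twice] the digit [b]
    may itself come from a large product. *)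
Lemma exceed_once n b s : 0 <= s <= 1 ->
  word_prob n s (fun w => (0 < exceed_count T b w)%N) <=
  exceed_bound T b + n%:R * exceed_rate T.
Proof.
elim: n b s => [|n IH] b s s01; have /andP[s0 s1] := s01.
  by rewrite /= mul0r addr0; have /andP[] := exceed_bound_itv b Tgt0.
have k0 := exceed_rate_ge0.
have bc := digit_bounded_cst (n%:R * exceed_rate T).
have b1 := digit_bounded_01 (fun a => T < (b * a)%:R).
have b2 := digit_boundedD b1 digit_bounded_eta; have b3 := digit_boundedD b2 bc.
apply: le_trans (word_prob_step s0 b3 _) _.
  move=> a a0; have u01 := inv_digit_itv s0 a0; have /andP[u0 _] := u01.
  have /andP[e0 _] := exceed_bound_itv a Tgt0.
  have n0 : 0 <= n%:R * exceed_rate T by rewrite mulr_ge0.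
  case: (boolP (T < (b * a)%:R)) => [h|/negbTE h].
    have /andP[_ p1] := word_prob_itv n
      (fun w => (0 < exceed_count T b (a :: w))%N) u0.
    by apply: (le_trans p1); rewrite -addrA lerDl addr_ge0.
  rewrite add0r /= h; exact: IH.
rewrite digit_expD// digit_expD// digit_exp_cst//.
have := digit_exp_exceed b s01 Tgt0; have := digit_exp_exceed_bound s01 T1.
by rewrite -[n.+1%:R]natr1 -/(exceed_rate T); lra.
Qed.

Definition pair_exceed_bound l b : R := 2 * l / T + 2 / l * exceed_bound T b.

Definition pair_exceed_rate l : R := 2 * l / T + 2 / l * exceed_rate T.

(* A single large [a] can make both neighbouring products large; the parameter [l]
   separates this case, [a > T / l], from that of two unrelated large products. *)
Lemma digit_exp_exceed_pair l b s : 0 < l -> 0 <= s <= 1 ->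
  digit_exp s (fun a => (T < (b * a)%:R)%R%:R * exceed_bound T a) <=
  pair_exceed_bound l b.
Proof.
move=> l0 s01; have /andP[s0 s1] := s01.
have b1 := digit_bounded_01 (fun a => T < (b * a)%:R).
have b2 := digit_bounded_01 (fun a => T / l < a%:R).
have b3 := digit_boundedZ (2 / l) b1; have b4 := digit_boundedD b2 b3.
have l2 : 0 <= 2 / l by rewrite divr_ge0// ltW.
apply: le_trans (_ : digit_exp s (fun a => (T / l < a%:R)%R%:R +
    2 / l * (T < (b * a)%:R)%R%:R) <= _).
  apply: digit_exp_le => //; first exact: digit_boundedM.
  move=> a a0; have /andP[e0 e1] := exceed_bound_itv a Tgt0.
  case: (T < (b * a)%:R); last by rewrite mul0r mulr0 addr0; case: (_ < _).
  rewrite mul1r mulr1; case: ltP => /= h; first by lra.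
  (* For [a <= T / l] the bound [2 a / T] is at most [2 / l]. *)
  rewrite add0r /exceed_bound ge_min; apply/orP; right.
  rewrite ler_pdivlMr// in h.
  by rewrite ler_pdivrMr// mulrAC ler_pdivlMr//; lra.
rewrite digit_expD// digit_expZ//; apply: lerD.
  by have := digit_tail_le s01 (divr_gt0 Tgt0 l0); rewrite invf_div mulrA.
by rewrite ler_wpM2l// digit_exp_exceed.
Qed.

(** After a first exceedance [exceed_once] bounds a second one; otherwise the induction hypothesis
    applies to the tail. The summands stand for the first product with its neighbour, the first
    product with a later one, and pairs avoiding the first. *)
Lemma exceed_twice l n b s : 0 < l -> 0 <= s <= 1 ->
  word_prob n s (fun w => (1 < exceed_count T b w)%N) <=
  pair_exceed_bound l b + n%:R * exceed_rate T * exceed_bound T b +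
  n%:R * (pair_exceed_rate l + n%:R * exceed_rate T ^+ 2).
Proof.
move=> l0; have k0 := exceed_rate_ge0.
have l2 : 0 <= 2 / l by rewrite divr_ge0// ltW.
have l3 : 0 <= 2 * l / T by rewrite divr_ge0// mulr_ge0// ltW.
have th0 a : 0 <= pair_exceed_bound l a.
  by rewrite addr_ge0// mulr_ge0//; have /andP[] := exceed_bound_itv a Tgt0.
have ta0 : 0 <= pair_exceed_rate l by rewrite addr_ge0// mulr_ge0.
elim: n b s => [|n IH] b s s01; have /andP[s0 s1] := s01.
  by rewrite /= !mul0r !addr0.
have nk0 : 0 <= n%:R * exceed_rate T by rewrite mulr_ge0.
have c0 : 0 <= n%:R * (pair_exceed_rate l + n%:R * exceed_rate T ^+ 2).
  by rewrite mulr_ge0// addr_ge0// mulr_ge0// sqr_ge0.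
have bc := digit_bounded_cst (n%:R * (pair_exceed_rate l + n%:R * exceed_rate T ^+ 2)).
have b1 := digit_bounded_01 (fun a => T < (b * a)%:R).
have b2 := digit_boundedM b1 digit_bounded_eta.
have b3 := digit_boundedZ (n%:R * exceed_rate T) b1.
have bcl := digit_bounded_cst (2 * l / T).
have b4 := digit_boundedZ (2 / l) digit_bounded_eta.
have b5 := digit_boundedD bcl b4.
have b6 := digit_boundedZ (n%:R * exceed_rate T) digit_bounded_eta.
have b7 := digit_boundedD b2 b3; have b8 := digit_boundedD b5 b6.
have b9 := digit_boundedD b7 b8; have b10 := digit_boundedD b9 bc.
apply: le_trans (word_prob_step s0 b10 _) _.
  move=> a a0; have u01 := inv_digit_itv s0 a0; have /andP[u0 _] := u01.
  have /andP[e0 _] := exceed_bound_itv a Tgt0.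
  have ne0 : 0 <= n%:R * exceed_rate T * exceed_bound T a by rewrite mulr_ge0.
  case: (boolP (T < (b * a)%:R)) => [h|/negbTE h].
    rewrite (_ : (fun w => _) = (fun w => (0 < exceed_count T a w)%N)).
      apply: le_trans (exceed_once n a u01) _.
      have := th0 a; rewrite /pair_exceed_bound => h1.
      by rewrite mul1r mulr1; lra.
    by apply/funext => w /=; rewrite h add1n ltnS.
  rewrite (_ : (fun w => _) = (fun w => (1 < exceed_count T a w)%N)).
    apply: le_trans (IH a _ u01) _.
    by rewrite /pair_exceed_bound mul0r mulr0 !add0r; lra.
  by apply/funext => w /=; rewrite h add0n.
rewrite digit_expD// digit_expD// (digit_expD s0 b2 b3) (digit_expD s0 b5 b6).
rewrite (digit_expD s0 bcl b4) (digit_expZ _ s0 b1).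
rewrite !(digit_expZ _ s0 digit_bounded_eta) !digit_exp_cst//.
have h1 := digit_exp_exceed_pair b l0 s01.
have h2 := ler_wpM2l nk0 (digit_exp_exceed b s01 Tgt0).
have h3 := digit_exp_exceed_bound s01 T1; rewrite -/(exceed_rate T) in h3.
have h4 := ler_wpM2l l2 h3; have h5 := ler_wpM2l nk0 h3.
have /andP[e0 _] := exceed_bound_itv b Tgt0.
have h6 : 0 <= exceed_rate T * exceed_bound T b by rewrite mulr_ge0.
have h7 := mulr_ge0 nk0 k0; have h8 := sqr_ge0 (exceed_rate T).
rewrite -[n.+1%:R]natr1 /pair_exceed_rate in c0 ta0 *.
by lra.
Qed.

Lemma exceed_count0 b w : exceed_count T b w = 0%N ->
  (prod_sum b w)%:R = trunc_sum T b w /\ (prod_max b w)%:R <= T.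
Proof.
elim: w b => [//|a w IH] b /= /eqP; rewrite addn_eq0 => /andP[/eqP h /eqP /IH[h1 h2]].
have {}h : (b * a)%:R <= T by rewrite leNgt; move: h; case: (_ < _).
rewrite /trunc_prod h natrD h1; split=> //.
by rewrite /maxn; case: ifP.
Qed.

Lemma exceed_count1 b w : exceed_count T b w = 1%N ->
  (prod_sum b w)%:R = trunc_sum T b w + (prod_max b w)%:R /\ T < (prod_max b w)%:R.
Proof.
elim: w b => [//|a w IH] b /=; case: (ltP T (b * a)%:R) => h /=.
  rewrite add1n => -[] /exceed_count0[h1 h2].
  rewrite /trunc_prod leNgt h /= natrD h1 (maxn_idPl _); last first.
    by rewrite -(ler_nat R) (le_trans h2)// ltW.
  by rewrite add0r addrC.
rewrite add0n => /IH[h1 h2]; rewrite /trunc_prod h natrD h1 (maxn_idPr _).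
  by rewrite addrA.
by rewrite -(ler_nat R) (le_trans h)// ltW.
Qed.

Lemma prod_sum_trunc b w : (exceed_count T b w <= 1)%N ->
  `|(prod_sum b w)%:R - (prod_max b w)%:R - trunc_sum T b w| <= T.
Proof.
rewrite leq_eqVlt ltnS leqn0 => /orP[/eqP /exceed_count1[-> _]|/eqP /exceed_count0[-> h]].
  by rewrite addrK subrr normr0.
by rewrite addrAC subrr add0r normrN ger0_norm.
Qed.

End WordEstimates.

Lemma prod_sum_map (a : nat -> nat) i n :
  prod_sum (a i) [seq a j | j <- iota i.+1 n] = (\sum_(i <= j < i + n) a j * a j.+1)%N.
Proof.
elim: n i => [|n IH] i /=; first by rewrite addn0 big_geq.
by rewrite big_ltn ?IH ?addSnnS// addnS ltnS leq_addr.
Qed.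

Lemma prod_max_map (a : nat -> nat) i n :
  prod_max (a i) [seq a j | j <- iota i.+1 n] = (\max_(i <= j < i + n) (a j * a j.+1))%N.
Proof.
elim: n i => [|n IH] i /=; first by rewrite addn0 big_geq.
by rewrite big_ltn ?IH ?addSnnS// addnS ltnS leq_addr.
Qed.

(** * Rates along geometric sequences *)

(** With [k ^ (1/4)] as the unit, all rates below are integer powers. *)
Definition root4 {R : realType} (k : nat) : R := Num.sqrt (Num.sqrt k%:R).

Section Rates.
Variable R : realType.
Implicit Types (k n : nat).

Lemma root4_ge1 k : (0 < k)%N -> 1 <= root4 k :> R.
Proof.
move=> k0; rewrite /root4 -[X in X <= _]sqrtr1 ler_wsqrtr// -[X in X <= _]sqrtr1.
by rewrite ler_wsqrtr// ler1n.
Qed.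

Lemma root4X k : root4 k ^+ 4 = k%:R :> R.
Proof. by rewrite (exprM _ 2 2) /root4 !sqr_sqrtr ?sqrtr_ge0. Qed.

Lemma ln_le_subr1 (u : R) : 0 < u -> ln u <= u - 1.
Proof.
move=> u0; have := @le_ln1Dx R (u - 1); rewrite (_ : 1 + (u - 1) = u); last by ring.
by apply; lra.
Qed.

(** This absorbs [osc_bound T ^+ 2] into the main variance term. With [u = T ^ (1/4)],
    [1 + ln T <= 4 u], and [256 = 4 ^ 4]. *)
Lemma ln_pow4_le (T : R) : 1 <= T -> (1 + ln T) ^+ 4 <= 256 * T.
Proof.
move=> T1; pose u := Num.sqrt (Num.sqrt T).
have u1 : 1 <= u.
  rewrite /u -[X in X <= _]sqrtr1 ler_wsqrtr// -[X in X <= _]sqrtr1.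
  by rewrite ler_wsqrtr.
have uT : u ^+ 4 = T by rewrite (exprM _ 2 2) /u !sqr_sqrtr ?sqrtr_ge0//; lra.
have lu := @ln_le_subr1 u (lt_le_trans ltr01 u1).
have L0 : 0 <= ln T by rewrite ln_ge0.
have LT : 1 + ln T <= 4 * u.
  by rewrite -{1}uT lnXn ?(lt_le_trans ltr01)// -mulr_natl; lra.
apply: le_trans (_ : (4 * u) ^+ 4 <= _).
  by rewrite ler_pXn2r// nnegrE; lra.
by rewrite exprMn uT -natrX.
Qed.

Lemma var_bound_le : exists2 C : R, 0 <= C &
  forall T : R, 1 <= T -> var_bound T <= C * (T * (1 + ln T)).
Proof.
pose q : R := 2 * 7371; exists (24 + 768 * q ^+ 2).
  by have := sqr_ge0 q; lra.
move=> T T1; have L0 : 0 <= ln T by rewrite ln_ge0.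
have h := ln_pow4_le T1.
have -> : var_bound T = 24 * T * (1 + ln T) + 3 * (q ^+ 2 * (1 + ln T) ^+ 4).
  by rewrite /var_bound /osc_bound mulrA -/q; ring.
move: q => q.
have h2 := ler_wpM2l (sqr_ge0 q) h.
have T0 : 0 <= T by lra.
have h3 := mulr_ge0 (mulr_ge0 (sqr_ge0 q) T0) L0.
by lra.
Qed.

Variable c : R.
Hypothesis c1 : 1 < c.

(* With [r = k ^ (1/4)] this is [c ^ k * k ^ (7/4)]: for [n ~ c ^ k] the relative
   variance and the probability of two exceedances are then both [O (k ^ (-5/4))]. *)
Definition level k : R := c ^+ k * root4 k ^+ 7.

Let lc : R := ln c.
Let lc0 : 0 < lc. Proof. by rewrite ln_gt0. Qed.

Lemma geom_ge1 k : 1 <= c ^+ k.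
Proof. by rewrite exprn_ege1// ltW. Qed.

Lemma geom_ge_linear k : k%:R * (c - 1) <= c ^+ k.
Proof.
elim: k => [|k IH]; first by rewrite mul0r.
have := geom_ge1 k; rewrite exprS -natr1 => h.
have : 0 <= (c - 1) * (c ^+ k - 1) by rewrite mulr_ge0// subr_ge0// ltW.
by lra.
Qed.

Lemma level_ge1 k : (0 < k)%N -> 1 <= level k.
Proof.
by move=> k0; rewrite /level mulr_ege1 ?geom_ge1// exprn_ege1// root4_ge1.
Qed.

Lemma ln_level k : (0 < k)%N -> k%:R * lc <= ln (level k) <= k%:R * lc + 7 * root4 k.
Proof.
move=> k0; have r1 : 1 <= root4 k :> R by exact: root4_ge1.
have r0 : 0 < root4 k :> R by lra.
have h := ln_le_subr1 r0; have h0 : 0 <= ln (root4 k : R) by rewrite ln_ge0.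
have c0 : 0 < c := lt_trans ltr01 c1.
rewrite /level lnM ?posrE ?exprn_gt0// !lnXn// -[ln c *+ k]mulr_natl -[_ *+ 7]mulr_natl -/lc.
by apply/andP; split; lra.
Qed.

Lemma ln_level_le k : (0 < k)%N -> 1 + ln (level k) <= (8 + lc) * root4 k ^+ 4.
Proof.
move=> k0; have /andP[_ h] := ln_level k0.
have r1 : 1 <= root4 k :> R by exact: root4_ge1.
have r4 : root4 k <= root4 k ^+ 4 :> R by rewrite ler_eXnr.
by rewrite -(root4X k) in h; lra.
Qed.

Lemma truncn_geom k : c ^+ k - 1 <= (Num.truncn (c ^+ k))%:R <= c ^+ k.
Proof.
have := truncn_itv (le_trans ler01 (geom_ge1 k)).
by rewrite -natr1 => /andP[h1 h2]; apply/andP; split; lra.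
Qed.

(** All errors are at most of the order of the truncation level, smaller than the main term by a
    factor [root4 k]. *)
Lemma mean_sum_rate : exists2 K : R, 0 <= K & forall k, (0 < k)%N ->
  `|mean_sum (level k) (Num.truncn (c ^+ k)).+1 0 0 -
     lc ^+ 2 / (2 * ln 2) * (c ^+ k * root4 k ^+ 8)| + level k <=
  K * (c ^+ k * root4 k ^+ 7).
Proof.
pose C1 := 8 + lc; pose v : R := (2 * ln 2)^-1; pose d := (c - 1)^-1.
have ln2 : 0 < ln (2 : R) by rewrite ln_gt0// ltr1n.
have v0 : 0 < v by rewrite invr_gt0; lra.
have d0 : 0 < d by rewrite invr_gt0 subr_gt0.
(* One summand each for [A0], [A4], [A5] and the added [level k]; 18 is half of the 36 in
   [transfer_sum_add1]. *)
exists (12 * C1 + 18 * (C1 ^+ 2 * d) + v * (C1 ^+ 2 * d + (14 * lc + 49)) + 1).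
  have h1 : 0 <= C1 ^+ 2 * d by rewrite mulr_ge0 ?sqr_ge0// ltW.
  have h2 : 0 <= v * (C1 ^+ 2 * d + (14 * lc + 49)) by rewrite mulr_ge0//; have := lc0; lra.
  have h3 : 0 <= C1 by have := lc0; rewrite /C1; lra.
  by lra.
move=> k k0; set T := level k; set X := c ^+ k; set n := Num.truncn X.
set r := root4 k; have r1 : 1 <= r := root4_ge1 k0.
have T1 : 1 <= T := level_ge1 k0; have X1 : 1 <= X := geom_ge1 k.
have /andP[n1 n2] : X - 1 <= n%:R <= X := truncn_geom k.
have n0 : 0 <= n%:R :> R by [].
have hL : 1 + ln T <= C1 * r ^+ 4 := ln_level_le k0.
have L0 : 0 <= ln T by rewrite ln_ge0.
have k4 : k%:R = r ^+ 4 by rewrite root4X.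
have rX : r ^+ 4 <= X * d.
  by have := geom_ge_linear k; rewrite k4 -ler_pdivlMr// subr_gt0.
have rp m1 m2 : (m1 <= m2)%N -> r ^+ m1 <= r ^+ m2 by move=> m12; rewrite ler_weXn2l.
have r70 : 0 <= r ^+ 7 by rewrite exprn_ge0//; lra.
have z01 : 0 <= (0 : R) <= 1 by rewrite lexx ler01.
have e0 : prod_mean T 0 0 = 0.
  rewrite -[RHS](@digit_exp_cst R 0 0)//; apply: eq_digit_exp => a _.
  by rewrite /trunc_prod mul0n if_same.
have app t : 0 <= t <= 1 -> `|pair_mean T t - ln T ^+ 2 / 2 * (1 + t)| <= 12 * (1 + ln T).
  by move=> t01; exact: pair_mean_approx.
have h1 := transfer_sum_dist n (weight_lip_pair_mean T1) (@weight_lip_add1 R) app z01.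
have h2 := transfer_sum_add1 n z01.
rewrite /mean_sum e0 add0r.
move: h1 h2; set S := transfer_sum _ _ _; set S1 := transfer_sum _ _ _ => h1 h2.
have A1 : n%:R * (1 + ln T) <= C1 * (X * r ^+ 7).
  apply: le_trans (ler_pM _ _ n2 hL) _; rewrite ?addr_ge0//.
  rewrite mulrCA ler_wpM2l ?addr_ge0 ?(ltW lc0)// ler_wpM2l ?rp//; lra.
have A2 : ln T ^+ 2 <= C1 ^+ 2 * d * (X * r ^+ 7).
  apply: le_trans (_ : (C1 * r ^+ 4) ^+ 2 <= _).
    by rewrite ler_pXn2r ?nnegrE//; lra.
  rewrite exprMn -mulrA ler_wpM2l ?sqr_ge0//.
  rewrite -exprM (_ : 4 * 2 = 4 + 4)%N// exprD mulrA (mulrC d).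
  apply: (ler_pM _ _ rX); rewrite ?exprn_ge0//; try lra; exact: rp.
have /andP[g1 g2] : k%:R * lc <= ln T <= k%:R * lc + 7 * r := ln_level k0.
rewrite k4 in g1 g2.
set y := r ^+ 4 * lc in g1 g2.
have y0 : 0 <= y by rewrite mulr_ge0 ?exprn_ge0// ?(ltW lc0)//; lra.
have A3 : `|n%:R * ln T ^+ 2 - X * y ^+ 2| <=
    (C1 ^+ 2 * d + (14 * lc + 49)) * (X * r ^+ 7).
  have e1 : ln T ^+ 2 - y ^+ 2 <= 14 * r * y + 49 * r ^+ 2.
    have q : 0 <= (y + 7 * r - ln T) * (y + 7 * r + ln T) by rewrite mulr_ge0//; lra.
    by nra.
  have e2 : 0 <= ln T ^+ 2 - y ^+ 2.
    have q : 0 <= (ln T - y) * (ln T + y) by rewrite mulr_ge0//; lra.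
    by nra.
  have e3 : 14 * r * y + 49 * r ^+ 2 <= (14 * lc + 49) * r ^+ 7.
    have -> : 14 * r * y = 14 * lc * r ^+ 5 by rewrite /y; ring.
    have l0 := ltW lc0; have p1 := rp 5 7 isT; have p2 := rp 2 7 isT.
    by have := ler_wpM2l l0 p1; lra.
  have X0 : 0 <= X by lra.
  have e4 := ler_wpM2l X0 (le_trans e1 e3).
  have e5 : 0 <= (X - n%:R) * ln T ^+ 2 by rewrite mulr_ge0 ?sqr_ge0//; lra.
  have e6 : 0 <= (n%:R - (X - 1)) * ln T ^+ 2 by rewrite mulr_ge0 ?sqr_ge0//; lra.
  have e7 := mulr_ge0 X0 e2.
  by rewrite ler_norml; apply/andP; split; nra.
have A4 : `|ln T ^+ 2 / 2 * (S1 - n%:R / ln 2)| <= 18 * (C1 ^+ 2 * d * (X * r ^+ 7)).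
  rewrite normrM ger0_norm; last by rewrite divr_ge0 ?sqr_ge0.
  have := ler_wpM2l (sqr_ge0 (ln T)) h2.
  by lra.
(* Three replacements: [pair_mean] by a multiple of [1 + s], the sum of iterates by its Gauss mean,
   and [n (ln T) ^+ 2] by [c ^+ k (k ln c) ^+ 2]. *)
have E : S - lc ^+ 2 / (2 * ln 2) * (X * r ^+ 8) =
    (S - ln T ^+ 2 / 2 * S1) + ln T ^+ 2 / 2 * (S1 - n%:R / ln 2) +
    v * (n%:R * ln T ^+ 2 - X * y ^+ 2).
  rewrite /y /v; field; lra.
have A5 : `|v * (n%:R * ln T ^+ 2 - X * y ^+ 2)| <=
    v * ((C1 ^+ 2 * d + (14 * lc + 49)) * (X * r ^+ 7)).
  by rewrite normrM (ger0_norm (ltW v0)) ler_wpM2l// ltW.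
rewrite E.
apply: (@le_trans _ _ (`|S - ln T ^+ 2 / 2 * S1| +
   `|ln T ^+ 2 / 2 * (S1 - n%:R / ln 2)| +
   `|v * (n%:R * ln T ^+ 2 - X * y ^+ 2)| + T)).
  by rewrite lerD2r (le_trans (ler_normD _ _))// lerD2r ler_normD.
have -> : T = X * r ^+ 7 by [].
have A0 : `|S - ln T ^+ 2 / 2 * S1| <= 12 * (C1 * (X * r ^+ 7)).
  by apply: (le_trans h1); lra.
by lra.
Qed.

(** The summands are the bounds of [trunc_sum_chebyshev] and [exceed_twice] from the digit 0. Taking
    [l = k ^ (1/2)] balances [n l / T] against [n exceed_rate / l]. *)
Lemma bad_rate (e : R) : 0 < e -> exists2 C : R, 0 <= C & forall k, (0 < k)%N ->
  (Num.truncn (c ^+ k)).+1%:R * var_bound (level k) / (e * (c ^+ k * root4 k ^+ 8)) ^+ 2 +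
  (2 * root4 k ^+ 2 / level k + (Num.truncn (c ^+ k)).+1%:R *
     (pair_exceed_rate (level k) (root4 k ^+ 2) +
      (Num.truncn (c ^+ k)).+1%:R * exceed_rate (level k) ^+ 2)) <= C / root4 k ^+ 5.
Proof.
move=> e0; have [C2 C20 hC2] := var_bound_le; pose C1 := 8 + lc.
have C10 : 0 < C1 by have := lc0; rewrite /C1; lra.
(* The summands come from [t1] to [t5] below, in this order. *)
exists (2 * C2 * C1 / e ^+ 2 + (2 + (4 + 24 * C1 + 144 * C1 ^+ 2))).
  have h1 : 0 <= 2 * C2 * C1 / e ^+ 2.
    apply: divr_ge0; last exact: sqr_ge0.
    by apply: mulr_ge0 (ltW C10); rewrite mulr_ge0.
  by have := sqr_ge0 C1; lra.
move=> k k0; set T := level k; set X := c ^+ k; set r := root4 k.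
set n := (Num.truncn X).+1.
have r1 : 1 <= r := root4_ge1 k0; have r0 : 0 < r by lra.
have T1 : 1 <= T := level_ge1 k0; have X1 : 1 <= X := geom_ge1 k.
have X0 : 0 < X by lra.
have TE : T = X * r ^+ 7 by [].
have /andP[_ n2] : X - 1 <= (Num.truncn X)%:R <= X := truncn_geom k.
have n2X : n%:R <= 2 * X by rewrite /n -natr1; lra.
have n0 : 0 <= n%:R :> R by [].
have hL : 1 + ln T <= C1 * r ^+ 4 := ln_level_le k0.
have L0 : 0 <= ln T by rewrite ln_ge0.
have r5 : 0 < r ^+ 5 by rewrite exprn_gt0.
have T0 : 0 <= T by lra.
have t1 : n%:R * var_bound T / (e * (X * r ^+ 8)) ^+ 2 <= 2 * C2 * C1 / e ^+ 2 / r ^+ 5.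
  have -> : 2 * C2 * C1 / e ^+ 2 / r ^+ 5 =
      (2 * X * (C2 * (X * r ^+ 7 * (C1 * r ^+ 4)))) / (e * (X * r ^+ 8)) ^+ 2.
    by field; rewrite !gt_eqF.
  rewrite ler_wpM2r ?invr_ge0 ?sqr_ge0//.
  apply: le_trans (ler_wpM2l n0 (hC2 T T1)) _.
  apply: (ler_pM _ _ n2X) => //; first exact: mulr_ge0 C20 (mulr_ge0 T0 (addr_ge0 ler01 L0)).
  by rewrite ler_wpM2l// -TE ler_wpM2l.
have k1 : exceed_rate T <= 6 * C1 / (X * r ^+ 3).
  have -> : 6 * C1 / (X * r ^+ 3) = 6 * (C1 * r ^+ 4) / T.
    by rewrite TE; field; rewrite !gt_eqF.
  by rewrite ler_wpM2r ?invr_ge0//; lra.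
have k00 : 0 <= exceed_rate T by exact: exceed_rate_ge0.
have t2 : 2 * r ^+ 2 / T <= 2 / r ^+ 5.
  have -> : 2 / r ^+ 5 = 2 * r ^+ 2 / (r ^+ 7) by field; rewrite gt_eqF.
  apply: ler_wpM2l; first by rewrite mulr_ge0 ?sqr_ge0.
  rewrite lef_pV2 ?posrE ?exprn_gt0 ?(lt_le_trans ltr01 T1)//.
  by rewrite TE ler_peMl// exprn_ge0 ?ltW.
have t3 : n%:R * (2 * r ^+ 2 / T) <= 4 / r ^+ 5.
  have -> : 4 / r ^+ 5 = 2 * X * (2 * r ^+ 2 / T) by rewrite TE; field; rewrite !gt_eqF.
  by rewrite ler_wpM2r// divr_ge0// mulr_ge0// sqr_ge0.
have t4 : n%:R * (2 / r ^+ 2 * exceed_rate T) <= 24 * C1 / r ^+ 5.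
  have -> : 24 * C1 / r ^+ 5 = 2 * X * (2 / r ^+ 2 * (6 * C1 / (X * r ^+ 3))).
    by field; rewrite !gt_eqF.
  apply: (ler_pM _ _ n2X) => //; first by rewrite mulr_ge0// divr_ge0// sqr_ge0.
  by rewrite ler_wpM2l// divr_ge0// sqr_ge0.
have t5 : n%:R * (n%:R * exceed_rate T ^+ 2) <= 144 * C1 ^+ 2 / r ^+ 5.
  apply: le_trans (_ : 2 * X * (2 * X * (6 * C1 / (X * r ^+ 3)) ^+ 2) <= _).
    apply: (ler_pM _ _ n2X) => //; first by rewrite mulr_ge0// sqr_ge0.
    apply: (ler_pM _ _ n2X) => //; first by rewrite sqr_ge0.
    by rewrite ler_pXn2r ?nnegrE// (le_trans k00).
  have -> : 2 * X * (2 * X * (6 * C1 / (X * r ^+ 3)) ^+ 2) = 144 * C1 ^+ 2 / r ^+ 6.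
    by field; rewrite !gt_eqF.
  apply: ler_wpM2l; first by rewrite mulr_ge0 ?sqr_ge0.
  by rewrite lef_pV2 ?posrE ?exprn_gt0// ler_weXn2l.
rewrite /pair_exceed_rate -/T -/X -/r.
rewrite [X in _ <= X]mulrDl [X in _ <= _ + X]mulrDl.
rewrite [X in _ <= _ + (_ + X)]mulrDl [X in _ <= _ + (_ + (X + _))]mulrDl.
by lra.
Qed.

(** Comparison of [k ^ (-5/4)] with the increments of its antiderivative [- 4 k ^ (-1/4)], through
    [w ^+ 4 - u ^+ 4 = 1]. *)
Lemma sum_inv_root4_le n : \sum_(0 <= k < n) (root4 k.+1 : R) ^- 5 <= 5.
Proof.
suff : \sum_(0 <= k < n.+1) (root4 k.+1 : R) ^- 5 <= 5 - 4 / root4 n.+1.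
  rewrite big_nat_recr//= => h.
  have : 0 <= (root4 n.+1 : R) ^- 5 by rewrite invr_ge0 exprn_ge0// sqrtr_ge0.
  have : 0 <= 4 / (root4 n.+1 : R) by rewrite divr_ge0// sqrtr_ge0.
  by lra.
elim: n => [|n IH].
  have r1 : root4 1 = 1 :> R by rewrite /root4 !sqrtr1.
  by rewrite big_nat1 r1 expr1n invr1; lra.
rewrite big_nat_recr//=; apply: le_trans (lerD IH (lexx _)) _.
have h1 := @root4_ge1 n.+1 isT; have h2 := @root4_ge1 n.+2 isT.
have h3 := root4X n.+1; have h4 := root4X n.+2.
move: (root4 n.+1 : R) (root4 n.+2 : R) h1 h2 h3 h4 => u w u1 w1 uE wE.
have uw : u <= w by rewrite -(@ler_pXn2r _ 4) ?nnegrE ?uE ?wE ?ler_nat//; lra.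
have E : (w - u) * (w ^+ 3 + w ^+ 2 * u + w * u ^+ 2 + u ^+ 3) = 1.
  have -> : (w - u) * (w ^+ 3 + w ^+ 2 * u + w * u ^+ 2 + u ^+ 3) = w ^+ 4 - u ^+ 4.
    by ring.
  by rewrite uE wE -natr1; lra.
have le4 : w ^+ 3 + w ^+ 2 * u + w * u ^+ 2 + u ^+ 3 <= 4 * w ^+ 3.
  have u0 : 0 <= u by lra.
  have w0 : 0 <= w by lra.
  have q1 : w ^+ 2 * u <= w ^+ 3 by rewrite [w ^+ 3]exprSr ler_wpM2l ?sqr_ge0.
  have q2 : u ^+ 2 <= w ^+ 2 by rewrite ler_pXn2r// nnegrE.
  have q3 : w * u ^+ 2 <= w ^+ 3 by rewrite [w ^+ 3]exprS ler_wpM2l.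
  have q4 : u ^+ 3 <= w ^+ 3 by rewrite ler_pXn2r// nnegrE.
  by lra.
have D : 1 <= 4 * (w - u) * w ^+ 3.
  have wu : 0 <= w - u by rewrite subr_ge0.
  by have := ler_wpM2l wu le4; rewrite E; lra.
have D2 : w ^- 5 <= 4 / u - 4 / w.
  have -> : 4 / u - 4 / w = (4 * (w - u) * w ^+ 3) * (w * w ^+ 3 * u)^-1.
    by field; rewrite !gt_eqF//; lra.
  apply: le_trans (_ : (w * w ^+ 3 * u)^-1 <= _).
    rewrite lef_pV2 ?posrE ?mulr_gt0 ?exprn_gt0//; try lra.
    by rewrite -exprS [X in _ <= X]exprSr ler_wpM2l// exprn_ge0//; lra.
  by rewrite ler_peMl// invr_ge0 !mulr_ge0 ?exprn_ge0//; lra.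
by lra.
Qed.

End Rates.

(** * Almost sure convergence *)

Section Digits.
Variable R : realType.
Implicit Types (x : R) (n k : nat).

Lemma partial_quotient_tails x : 0 < x < 1 -> irrational x ->
  exists2 t : nat -> R, t 1%N = x & forall j, (0 < j)%N ->
    [/\ (0 < partial_quotient x j)%N, 0 <= t j <= 1 &
        t j = ((partial_quotient x j)%:R + t j.+1)^-1].
Proof.
move=> x01 irrx; have hx : 0 < x < 1 /\ irrational x by [].
have [a0 apos acvg] := partial_quotientP x01 irrx.
set a := partial_quotient x in a0 apos acvg *.
pose T (y : R) := y^-1 - (Num.truncn y^-1)%:R.
have ht i : 0 < iter i T x < 1 /\ irrational (iter i T x) by exact: irr01_iter.
have H i : cf_frac R a i.+1 n @[n --> \oo] --> iter i T x.
  by elim: i => // i IH; have [] := cf_tail apos (ltn0Sn i) (ht i) IH.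
exists (fun j => iter j.-1 T x) => // -[//|j] _.
have [/andP[t0 t1] _] := ht j; have [aE _] := cf_tail apos (ltn0Sn j) (ht j) (H j).
split; [exact: apos|by rewrite !ltW|].
by rewrite aE /= /T addrC subrK invrK.
Qed.

Lemma mem_cylinders_quotients x n (A : pred (seq nat)) : 0 < x < 1 -> irrational x ->
  A [seq partial_quotient x j | j <- iota 1 n] -> cylinders n 0 1 1 0 A x.
Proof.
move=> x01 irrx hA; have [t t1 ht] := partial_quotient_tails x01 irrx.
have := @mem_cylinders R (partial_quotient x) t n 1 0 1 1 0 A ht ltr01 (lexx 0) hA.
by rewrite t1 mul0r addr0 divr1 add0r mul1r.
Qed.

Lemma cf_SE x n :
  cf_S x n = prod_sum 0 [seq partial_quotient x j | j <- iota 1 n.+1].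
Proof. by rewrite /= mul0n add0n prod_sum_map add1n. Qed.

Lemma cf_maxE x n :
  cf_max x n = prod_max 0 [seq partial_quotient x j | j <- iota 1 n.+1].
Proof. by rewrite /= mul0n max0n prod_max_map add1n. Qed.

Definition trimmed_sum x n : R := (cf_S x n)%:R - (cf_max x n)%:R.

(** A new product raises the maximum by at most its own value. *)
Lemma trimmed_sum_nondecreasing x : {homo trimmed_sum x : m n / (m <= n)%N >-> m <= n}.
Proof.
apply: homo_leq => [//|y z w|n]; first exact: le_trans.
rewrite /trimmed_sum /cf_S /cf_max !(@big_nat_recr _ _ _ n.+1 1)//=.
set a := (_ * _)%N; set S := (\sum_(_ <= _ < _) _)%N; set M := \big[_/_]_(_ <= _ < _) _.
have : ((maxn M a)%:R : R) <= M%:R + a%:R.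
  by rewrite -natrD ler_nat geq_max leq_addr leq_addl.
by rewrite natrD; lra.
Qed.

(** Stated through [cylinders], whose measurability is immediate, rather than through
    [partial_quotient]. *)
Definition bad_set (c e : R) (k : nat) : set R :=
  let n := (Num.truncn (c ^+ k)).+1 in
  cylinders n 0 1 1 0 (fun w => e * (c ^+ k * root4 k ^+ 8) <=
    `|0 + trunc_sum (level c k) 0 w - mean_sum (level c k) n 0 0|) `|`
  cylinders n 0 1 1 0 (fun w => (1 < exceed_count (level c k) 0 w)%N).

Lemma measurable_bad_set c e k : measurable (bad_set c e k).
Proof. by apply: measurableU; exact: measurable_cylinders. Qed.

Lemma bad_set_measure c e : 1 < c -> 0 < e -> exists2 C : R, 0 <= C &
  forall k, (0 < k)%N ->
    (@lebesgue_measure R (bad_set c e k) <= (C / root4 k ^+ 5)%:E)%E.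
Proof.
move=> c1 e0; have [C C0 HC] := bad_rate c1 e0; exists C => // k k0.
have T1 := level_ge1 c1 k0; have r1 := @root4_ge1 R k k0.
have X1 := geom_ge1 c1 k.
have l0 : 0 < e * (c ^+ k * root4 k ^+ 8).
  by rewrite mulr_gt0// mulr_gt0 ?exprn_gt0//; lra.
have z01 : 0 <= (0 : R) <= 1 by rewrite lexx ler01.
apply: le_trans.
  by apply: measureU2; exact: measurable_cylinders.
(* The parameters [0 1 1 0] represent the identity map, with initial state [s = 0]. *)
have D : `|0 * 0 - 1 * 1| = 1 :> R by rewrite mul0r mul1r sub0r normrN normr1.
apply: le_trans (leeD (cylinders_measure _ _ ltr01 (lexx 0) D)
                      (cylinders_measure _ _ ltr01 (lexx 0) D)) _.
rewrite -EFinD lee_fin addr0 mulr1 !divr1.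
apply: le_trans (HC k k0); apply: lerD.
  apply: le_trans (trunc_sum_chebyshev T1 _ _ _ z01 l0) _.
  rewrite expr0n add0r /trunc_digit.
  have -> : (if (0%:R : R) <= level c k then 0%:R else 0) = 0 :> R by rewrite if_same.
  by rewrite mulr0 add0r.
apply: le_trans (exceed_twice T1 _ _ (_ : 0 < root4 k ^+ 2) z01) _.
  by rewrite exprn_gt0//; lra.
have e00 : exceed_bound (level c k) 0 = 0.
  by rewrite /exceed_bound mulr0 mul0r min_r// ler01.
by rewrite /pair_exceed_bound e00 !mulr0 !addr0.
Qed.

(** Borel-Cantelli; the shift to [k.+1] avoids [root4 0 = 0]. *)
Lemma bad_set_limsup c e : 1 < c -> 0 < e ->
  @lebesgue_measure R (lim_sup_set (fun k => bad_set c e k.+1)) = 0.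
Proof.
move=> c1 e0; have [C C0 HC] := bad_set_measure c1 e0.
apply: lim_sup_set_cvg0 => [k|]; first exact: measurable_bad_set.
apply: (@le_lt_trans _ _ (C * 5)%:E); last exact: ltry.
apply: lime_le; first by apply: is_cvg_nneseries => k _ _; exact: measure_ge0.
apply: nearW => n.
apply: le_trans (_ : (\sum_(0 <= k < n) (C / root4 k.+1 ^+ 5)%:E <= _)%E).
  by apply: lee_sum => k _; exact: HC.
rewrite sumEFin lee_fin -mulr_sumr ler_wpM2l//.
exact: sum_inv_root4_le.
Qed.

Lemma trimmed_sum_close c e k x : 1 < c -> 0 < e -> (0 < k)%N ->
  0 < x < 1 -> irrational x -> ~ bad_set c e k x ->
  `|trimmed_sum x (Num.truncn (c ^+ k)) -
     mean_sum (level c k) (Num.truncn (c ^+ k)).+1 0 0| <=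
  level c k + e * (c ^+ k * root4 k ^+ 8).
Proof.
move=> c1 e0 k0 x01 irrx /not_orP[h1 h2]; have T1 := level_ge1 c1 k0.
set n := Num.truncn (c ^+ k) in h1 h2 *.
set w := [seq partial_quotient x j | j <- iota 1 n.+1].
have {}h2 : (exceed_count (level c k) 0 w <= 1)%N.
  by rewrite leqNgt; apply/negP => h; apply: h2; exact: mem_cylinders_quotients.
have {}h1 : `|trunc_sum (level c k) 0 w - mean_sum (level c k) n.+1 0 0| <=
    e * (c ^+ k * root4 k ^+ 8).
  rewrite leNgt; apply/negP => h; apply: h1; apply: mem_cylinders_quotients => //.
  by rewrite add0r ltW.
have h3 := prod_sum_trunc T1 h2.
rewrite /trimmed_sum cf_SE cf_maxE -/w.
apply: le_trans (lerD h3 h1); apply: le_trans (ler_normD _ _).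
by rewrite le_eqVlt; apply/orP; left; apply/eqP; congr (`|_|); ring.
Qed.

Lemma ae_trimmed_sum_geom c e : 1 < c -> 0 < e ->
  {ae (@lebesgue_measure R), forall x, 0 < x < 1 -> irrational x ->
    \forall k \near \oo,
      `|trimmed_sum x (Num.truncn (c ^+ k)) -
        (ln c) ^+ 2 / (2 * ln 2) * (c ^+ k * k%:R ^+ 2)| <=
      e * (c ^+ k * k%:R ^+ 2)}.
Proof.
move=> c1 e0; have e2 : 0 < e / 2 by lra.
have [K K0 HK] := mean_sum_rate c1.
exists (lim_sup_set (fun k => bad_set c (e / 2) k.+1)); split.
- apply: bigcap_measurable => // n _.
  by apply: bigcup_measurable => k _; exact: measurable_bad_set.
- exact: bad_set_limsup.
move=> x /= H; apply: contrapT => xL; apply: H => x01 irrx.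
have [m hm] : exists m, forall k, (m <= k)%N -> ~ bad_set c (e / 2) k.+1 x.
  apply: contrapT => hn; apply: xL => m _.
  apply: contrapT => hm; apply: hn; exists m => k mk hk.
  by apply: hm; exists k.
(* Beyond [q] the error of [mean_sum_rate] costs at most half of [e]; the other half is the
   tolerance of [bad_set]. *)
pose q : R := (K / (e / 2)) ^+ 4.
near=> k.
have mk : (m < k)%N by near: k; exact: nbhs_infty_gt.
have k0 : (0 < k)%N by exact: leq_ltn_trans mk.
have kE : k.-1.+1 = k by rewrite prednK.
have nb : ~ bad_set c (e / 2) k x.
  by rewrite -kE; apply: hm; rewrite -ltnS kE.
have qk : q <= k%:R by near: k; exact: nbhs_infty_ger.
have r1 := @root4_ge1 R k k0.
have rK : K <= e / 2 * root4 k.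
  rewrite mulrC -ler_pdivrMr//.
  rewrite -(@ler_pXn2r _ 4) ?nnegrE ?root4X//; first by rewrite divr_ge0// ltW.
  by rewrite (le_trans _ r1).
have h1 := trimmed_sum_close c1 e2 k0 x01 irrx nb; have h2 := HK k k0.
have kr : k%:R ^+ 2 = root4 k ^+ 8 :> R by rewrite -root4X -exprM.
rewrite kr.
have X0 : 0 <= c ^+ k * root4 k ^+ 7 by rewrite mulr_ge0// exprn_ge0//; lra.
have h3 := ler_wpM2r X0 rK.
have h4 : e / 2 * root4 k * (c ^+ k * root4 k ^+ 7) = e / 2 * (c ^+ k * root4 k ^+ 8).
  by ring.
rewrite h4 in h3.
move: h1 h2 h3; set Z := trimmed_sum _ _; set M := mean_sum _ _ _ _.
set V := ln c ^+ 2 / _ * _; set B := e / 2 * _ => h1 h2 h3.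
have -> : e * (c ^+ k * root4 k ^+ 8) = B + B by rewrite /B; lra.
have -> : Z - V = (Z - M) + (M - V) by ring.
by apply: le_trans (ler_normD _ _) _; lra.
Unshelve. all: end_near. Qed.

(** For [c ^+ k <= n <= c ^+ k.+1] monotonicity encloses [Z n] between two controlled values, and
    the normalizations there differ by a factor of at most [c ^+ 2]. *)
Lemma geom_interpolation (Z : nat -> R) (v eta : R) :
  {homo Z : m n / (m <= n)%N >-> m <= n} ->
  1 / 2 <= v <= 1 -> 0 < eta <= 1 / 2 ->
  (\forall k \near \oo, `|Z (Num.truncn ((1 + eta) ^+ k)) -
      ln (1 + eta) ^+ 2 * v * ((1 + eta) ^+ k * k%:R ^+ 2)| <=
      eta * ln (1 + eta) ^+ 2 * ((1 + eta) ^+ k * k%:R ^+ 2)) ->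
  \forall n \near \oo, `|Z n / (n%:R * ln n%:R ^+ 2) - v| <= 10 * eta.
Proof.
move=> Zmono /andP[v1 v2] /andP[eta0 eta1] [K _ HK].
set c := 1 + eta in HK *; set lc := ln c in HK *.
have c1 : 1 < c by rewrite /c; lra.
have c0 : 0 < c by lra.
have lc0 : 0 < lc by rewrite ln_gt0.
have c2 : c ^+ 2 <= 1 + (5 / 2) * eta by rewrite /c; nra.
(* The bound [k >= 3 / eta] gives [(k + 1) ^+ 2 <= k ^+ 2 + 3 k <= c k ^+ 2]. *)
pose m := maxn K (Num.truncn (3 / eta)).+1.
near=> n.
have nm : c ^+ m <= n%:R by near: n; exact: nbhs_infty_ger.
have n0 : 0 < n%:R :> R by apply: lt_le_trans nm; rewrite exprn_gt0.
have n1 : 1 <= n%:R :> R by rewrite ler1n -(ltr0n R).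
have L0 : 0 <= ln (n%:R : R) by rewrite ln_ge0.
pose k := Num.truncn (ln n%:R / lc).
have /andP[k1 k2] := truncn_itv (divr_ge0 L0 (ltW lc0)).
rewrite -/k ler_pdivlMr// in k1; rewrite -/k ltr_pdivrMr// in k2.
have lcX j : ln (c ^+ j) = j%:R * lc by rewrite lnXn// mulr_natl.
have mk : (m <= k)%N.
  rewrite /k truncn_ge_nat ?divr_ge0 ?(ltW lc0)// ler_pdivlMr// -lcX.
  by rewrite ler_ln ?posrE// exprn_gt0.
clearbody k.
have Kk : (K <= k)%N by apply: leq_trans mk; exact: leq_maxl.
have ek : 3 / eta <= k%:R.
  apply: (le_trans (ltW (truncnS_gt _))); rewrite ler_nat.
  by apply: leq_trans mk; exact: leq_maxr.
have k0 : 0 < k%:R :> R by apply: lt_le_trans ek; rewrite divr_gt0.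
rewrite ler_pdivrMr// in ek.
have kc : k.+1%:R ^+ 2 <= c * k%:R ^+ 2 :> R.
  have k1' : 1 <= k%:R :> R by rewrite ler1n -(ltr0n R).
  rewrite -natr1 /c; have : 3 * k%:R <= eta * k%:R ^+ 2.
    by rewrite expr2 mulrA (mulrC eta) ler_pM2r.
  by nra.
have ckn : c ^+ k <= n%:R by rewrite -ler_ln ?posrE ?exprn_gt0// lcX.
have nck : n%:R <= c ^+ k.+1 by rewrite -ler_ln ?posrE ?exprn_gt0// lcX ltW.
have lo : Z (Num.truncn (c ^+ k)) <= Z n.
  by apply: Zmono; rewrite -[n in X in (_ <= X)%N](@natrK R); exact: le_truncn.
have up : Z n <= Z (Num.truncn (c ^+ k.+1)).
  by apply: Zmono; rewrite -[n in X in (X <= _)%N](@natrK R); exact: le_truncn.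
have := HK k Kk; rewrite ler_norml => /andP[lo' _].
have := HK k.+1 (leqW Kk); rewrite ler_norml => /andP[_ up'].
pose B := lc ^+ 2 * (c ^+ k * k%:R ^+ 2).
have l2 : 0 < lc ^+ 2 by rewrite exprn_gt0.
have ck0 : 0 < c ^+ k by rewrite exprn_gt0.
have B0 : 0 < B by rewrite /B !mulr_gt0// exprn_gt0.
have B1 : lc ^+ 2 * (c ^+ k.+1 * k.+1%:R ^+ 2) <= c ^+ 2 * B.
  rewrite /B (mulrCA (c ^+ 2)) ler_pM2l// exprS.
  rewrite (_ : c ^+ 2 * (c ^+ k * k%:R ^+ 2) = c * c ^+ k * (c * k%:R ^+ 2)); last by ring.
  by rewrite ler_pM2l// mulr_gt0.
set N := n%:R * ln n%:R ^+ 2.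
have N1 : B <= N.
  rewrite /B /N (_ : lc ^+ 2 * (c ^+ k * k%:R ^+ 2) = c ^+ k * (k%:R * lc) ^+ 2).
    by rewrite ler_pM ?sqr_ge0 ?(ltW ck0)// ler_pXn2r ?nnegrE// mulr_ge0 ?ltW.
  by move: (c ^+ k) (k%:R : R) => u y; ring.
have N2 : N <= c ^+ 2 * B.
  apply: le_trans B1.
  rewrite (_ : lc ^+ 2 * _ = c ^+ k.+1 * (k.+1%:R * lc) ^+ 2); last first.
    by move: (c ^+ k.+1) (k.+1%:R : R) => u y; ring.
  by rewrite ler_pM ?sqr_ge0 ?(ltW n0)// ler_pXn2r ?nnegrE ?mulr_ge0 ?(ltW lc0)// ltW.
have N0 : 0 < N by apply: lt_le_trans N1.
have lo2 : (v - eta) * B <= Z n by rewrite /B; lra.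
have up2 : Z n <= (v + eta) * (c ^+ 2 * B).
  have ve : 0 <= v + eta by lra.
  by have := ler_wpM2l ve B1; lra.
have up3 : Z n <= (v + 10 * eta) * N.
  have q1 : (v + eta) * c ^+ 2 <= v + 10 * eta by nra.
  apply: (le_trans up2); rewrite mulrA.
  apply: le_trans (ler_wpM2r (ltW B0) q1) _.
  by rewrite ler_wpM2l//; lra.
have lo3 : (v - 10 * eta) * N <= Z n.
  (* Multiplying [N2] by [v - 10 * eta] requires its sign. *)
  have [h|h] := leP (v - 10 * eta) 0.
    have h1 : (v - 10 * eta) * N <= 0 by rewrite mulr_le0_ge0// ltW.
    have h2 : 0 <= (v - eta) * B by rewrite mulr_ge0 ?(ltW B0)//; lra.
    by lra.
  have q1 : (v - 10 * eta) * c ^+ 2 <= v - eta by nra.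
  apply: le_trans lo2; apply: le_trans (ler_wpM2l (ltW h) N2) _.
  by rewrite mulrA ler_wpM2r// ltW.
by rewrite ler_norml lerBrDr lerBlDr ler_pdivlMr// ler_pdivrMr//; apply/andP; split; lra.
Unshelve. all: end_near. Qed.

(** [1 / 2 <= ln 2 <= 1] is [ln u <= u - 1] at [u = 1 / 2] and [u = 2]. *)
Lemma ln2_inv_itv : 1 / 2 <= 1 / (2 * ln (2 : R)) <= 1.
Proof.
have h1 := @ln_le_subr1 R 2 ltac:(lra); have h2 := @ln_le_subr1 R (2^-1) ltac:(lra).
rewrite lnV ?posrE// in h2.
have h0 : 0 < 2 * ln (2 : R) by lra.
by apply/andP; split; rewrite ?ler_pdivlMr ?ler_pdivrMr//; lra.
Qed.

Lemma negligible_rational :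
  {ae (@lebesgue_measure R), forall x : R, irrational x}.
Proof.
have cq : countable (@rational R).
  by apply: card_le_trans (card_image_le _ _) _; exact: countableP.
exists rational; split.
- by apply: countable_measurable => // t; exact: measurable_set1.
- exact: countable_lebesgue_measure0.
- by move=> x /= /contrapT.
Qed.

End Digits.

Unset Implicit Arguments.

Theorem theorem1p5 (R : realType) :
  {ae (@lebesgue_measure R), forall x : R, 0 < x < 1 ->
    ((cf_S x n)%:R - (cf_max x n)%:R) / (n%:R * (ln n%:R) ^+ 2)
      @[n --> \oo] --> 1 / (2 * ln (2 : R)) }.
Proof.
pose v : R := 1 / (2 * ln 2); have v12 : 1 / 2 <= v <= 1 := ln2_inv_itv R.
pose eta (j : nat) : R := j.+2%:R^-1.
have eta_itv j : 0 < eta j <= 1 / 2.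
  by rewrite /eta invr_gt0 ltr0n/= mul1r lef_pV2 ?posrE// ler_nat.
have F : Filter (nbhs (almost_everywhere (@lebesgue_measure R))).
  exact: ae_filter_ringOfSetsType.
(* The exceptional set depends on the tolerance, so only the countably many [eta j] are used. *)
have A : {ae (@lebesgue_measure R), forall x, forall j, 0 < x < 1 -> irrational x ->
    \forall n \near \oo,
      `|trimmed_sum x n / (n%:R * ln n%:R ^+ 2) - v| <= 10 * eta j}.
  apply: ae_foralln => j; have /andP[e0 e1] := eta_itv j.
  have c1 : 1 < 1 + eta j by lra.
  have l2 : 0 < ln (1 + eta j) ^+ 2 by rewrite exprn_gt0// ln_gt0.
  have := ae_trimmed_sum_geom c1 (mulr_gt0 e0 l2); apply: filterS => x H x01 irrx.
  apply: geom_interpolation v12 (eta_itv j) _.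
    exact: trimmed_sum_nondecreasing.
  apply: filterS (H x01 irrx) => k.
  by rewrite /v mul1r.
have := negligible_rational R; apply: filterS2 A => x H irrx x01.
apply/cvgrPdist_le => e e0.
pose j := Num.truncn (10 / e).
have je : 10 * eta j <= e.
  have := truncnS_gt (10 / e); rewrite -/j ltr_pdivrMr// => h.
  rewrite /eta ler_pdivrMr ?ltr0n// mulrC; apply: (le_trans (ltW h)).
  by rewrite ler_pM2r// ler_nat.
apply: filterS (H j x01 irrx) => n hn; rewrite distrC.
exact: le_trans hn je.
Qed.
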